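(* Let $A\in\mathbb{R}^{n_x\times n_x}$, $B\in\mathbb{R}^{n_x\times n_u}$, $E\in\mathbb{R}^{n_x\times n_w}$, $K\in\mathbb{R}^{n_u\times n_x}$, $\Sigma_w\succ 0$ in $\mathbb{R}^{n_w\times n_w}$ and $\varepsilon\in(0,1)$. Assume $\|A+BK\|<1$, $(A+BK,E)$ is reachable, and $BK\neq 0$. Let $P\succ0$ be the solution of $(A+BK)P(A+BK)^\top-P+E\Sigma_wE^\top=0$, and suppose $r>0$ satisfies $r^2>\frac1\varepsilon\operatorname{Tr}(P)$. Consider the system $x_{t+1}=Ax_t+Bu_t+Ew_t$ with the event-triggered control $u_t=K\hat x_t$, where $\hat x_t=x_{t_k}$ for $t\in[t_k,t_{k+1})$, $t_0=0$, and the triggering times are $$t_{k+1}=\min\{t>t_k:\ \|x_{t_k}-x_t\|>\sigma_1\}.$$ If $$\sigma_1\le\frac{1-\|A+BK\|}{\|BK\|}\left(r-\sqrt{\frac1\varepsilon\operatorname{Tr}(P)}\right),$$ then ultimate boundedness with $\mathcal{D}=\{x\in\mathbb{R}^{n_x}:\|x\|^2-r^2\le0\}$ is guaranteed: for every initial state $x_0$ there exists $T=T(x_0)>0$ such that $\sup_{\mathbb{P}\in\mathcal{P}_t}\mathbb{P}\text{-CVaR}_\varepsilon[\|x_t\|^2-r^2]\le0$ for all $t\ge T$.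
   Context: $\|\cdot\|$ is the Euclidean norm on vectors and the maximum singular value on matrices; $M\succ 0$ means positive definite. Reachability of $(A+BK,E)$ means $\operatorname{rank}[E,(A+BK)E,\dots,(A+BK)^{n_x-1}E]=n_x$. CVaR: for a probability distribution $\mathbb{P}$ of a random vector $\xi$ and a measurable loss $L$, at level $\varepsilon\in(0,1)$, $\mathbb{P}\text{-CVaR}_\varepsilon[L(\xi)]=\inf_{\beta\in\mathbb{R}}\{\beta+\frac1\varepsilon\mathbb{E}_{\mathbb{P}}[(L(\xi)-\beta)^+]\}$, where $x^+=\max\{x,0\}$. The worst-case CVaR over a set of distributions is the supremum of CVaR over that set. Setting: $x_0$ is a given deterministic vector and the disturbances $w_t\in\mathbb{R}^{n_w}$, $t\in\mathbb{Z}_{\ge0}$, are i.i.d. with mean zero and covariance $\Sigma_w$, but their distribution is otherwise unknown. For $t\ge1$, $\bar w_t=[w_0^\top,\dots,w_{t-1}^\top]^\top$, and $\mathcal{P}_t$ is the set of all probability distributions of $\bar w_t$ on $\mathbb{R}^{n_wt}$ with mean zero and covariance $I_t\otimes\Sigma_w$. Under the event-triggered control, $x_t$ is a function of $x_0$ and $\bar w_t$. With $e_t=\hat x_t-x_t$ the closed loop reads $x_{t+1}=(A+BK)x_t+BKe_t+Ew_t$. If the set defining $t_{k+1}$ is empty, $t_{k+1}=\infty$; at a triggering time $\hat x_t$ is reset to $x_t$ (so $e_t=0$). *)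

(* Defs.v *)
From HB Require Import structures.
From mathcomp Require Export all_boot all_order all_algebra mxtens.
From mathcomp Require Export all_classical all_reals all_analysis.

Import Order.TTheory GRing.Theory Num.Theory.
Import numFieldNormedType.Exports.

Local Open Scope classical_set_scope.
Local Open Scope ring_scope.

(* The norm that MathComp-Analysis puts on matrices is the max norm, hence the
   separate definition of the Euclidean norm. *)
Definition enorm {R : realType} {n : nat} (v : 'cV[R]_n) : R :=
  Num.sqrt (\sum_(i < n) v i 0 ^+ 2).

Definition singular_value {R : realType} {m n : nat} (M : 'M[R]_(m, n)) (s : R)
  : Prop := 0 <= s /\ eigenvalue (M^T *m M) (s ^+ 2).

(* The set of singular values is finite, and nonempty when [0 < n], so [sup] is
   then a maximum. *)
Definition specnorm {R : realType} {m n : nat} (M : 'M[R]_(m, n)) : R :=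
  sup [set s | singular_value M s].

Definition posdefmx {R : realType} {n : nat} (M : 'M[R]_n) : Prop :=
  M^T = M /\ forall v : 'cV[R]_n, v != 0 -> 0 < (v^T *m M *m v) 0 0.

Definition reachable {R : realType} {n m : nat} (F : 'M[R]_n) (G : 'M[R]_(n, m))
  : Prop := \rank (\mxrow_(i < n) (F ^+ i *m G)) = n.

Definition cvar {R : realType} {d : measure_display} {T : measurableType d}
    (P : probability T R) (eps : R) (L : T -> R) : \bar R :=
  ereal_inf [set (beta%:E
      + (eps^-1)%:E * 'E_P[fun x => (Num.max (L x - beta) 0)%R])%E
    | beta in [set: R]].

Definition worst_case_cvar {R : realType} {d : measure_display}
    {T : measurableType d} (Ps : set (probability T R)) (eps : R) (L : T -> R)
  : \bar R := ereal_sup [set cvar P eps L | P in Ps].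

Definition coord {R : realType} {n : nat} (k : 'I_n) (v : n.-tuple R) : R :=
  tnth v k.

(* R^(nw t) is [(t * nw).-tuple R] with its product sigma-algebra. The i-th
   entry of the s-th block has index [s * nw + i], in agreement with the
   indexing of the Kronecker product [*t]. *)
Definition ambiguity_set {R : realType} {nw : nat} (Sigma_w : 'M[R]_nw) (t : nat)
  : set (probability ((t * nw)%N.-tuple R) R) :=
  [set P : probability ((t * nw)%N.-tuple R) R |
    [/\ forall k, coord k \in Lfun P 2%:E,
        forall k, ('E_P[coord k] = 0)%E
      & forall k l, covariance P (coord k) (coord l) =
          (((1%:M : 'M[R]_t) *t Sigma_w) k l)%:E]].

(* The disturbance sequence with first blocks [wbar], continued by zero; the
   continuation does not affect x_0, ..., x_t
   (see [event_triggered_loop_causal]). *)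
Definition unstack {R : realType} {nw t : nat} (wbar : (t * nw)%N.-tuple R)
    (s : nat) : 'cV[R]_nw :=
  \col_(i < nw) nth 0 wbar (s * nw + i)%N.

(* Times are in [option nat], with [None] standing for infinity, which is
   also the minimum of the empty set. *)
Definition is_min (S : set nat) (m : option nat) : Prop :=
  if m is Some t then S t /\ forall s, S s -> (t <= s)%N else S = set0.

Definition before (t : nat) (m : option nat) : bool :=
  if m is Some s then (t < s)%N else true.

Definition trigger_set {R : realType} {nx : nat} (sigma1 : R)
    (x : nat -> 'cV[R]_nx) (s : option nat) : set nat :=
  [set t | if s is Some s' then (s' < t)%N /\ sigma1 < enorm (x s' - x t)
           else False].

Record event_triggered_loop {R : realType} {nx nu nw : nat} (A : 'M[R]_nx)
    (B : 'M[R]_(nx, nu)) (E : 'M[R]_(nx, nw)) (K : 'M[R]_(nu, nx)) (sigma1 : R)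
    (x0 : 'cV[R]_nx) (w : nat -> 'cV[R]_nw)
    (x xhat : nat -> 'cV[R]_nx) (u : nat -> 'cV[R]_nu) (tau : nat -> option nat)
  : Prop := EventTriggeredLoop {
  etl_init : x 0%N = x0;
  etl_dyn : forall t, x t.+1 = A *m x t + B *m u t + E *m w t;
  etl_ctrl : forall t, u t = K *m xhat t;
  etl_hold : forall k tk t, tau k = Some tk -> (tk <= t)%N ->
    before t (tau k.+1) -> xhat t = x tk;
  etl_tau0 : tau 0%N = Some 0%N;
  etl_tauS : forall k, is_min (trigger_set sigma1 x (tau k)) (tau k.+1) }.

Lemma event_triggered_loop_exists {R : realType} {nx nu nw : nat}
    (A : 'M[R]_nx) (B : 'M[R]_(nx, nu)) (E : 'M[R]_(nx, nw))
    (K : 'M[R]_(nu, nx)) (sigma1 : R) (x0 : 'cV[R]_nx) (w : nat -> 'cV[R]_nw) :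
  exists x xhat u tau,
    event_triggered_loop A B E K sigma1 x0 w x xhat u tau.
Proof.
pose step t (p : 'cV[R]_nx * 'cV[R]_nx) :=
  let y := A *m p.1 + B *m (K *m p.2) + E *m w t in
  (y, if sigma1 < enorm (p.2 - y) then y else p.2).
pose z := fix z t := if t is s.+1 then step s (z s) else (x0, x0).
pose x t := (z t).1; pose xhat t := (z t).2.
have xhatS t : xhat t.+1 = if sigma1 < enorm (xhat t - x t.+1)
  then x t.+1 else xhat t by [].
have minP (S : set nat) : exists m, is_min S m.
  have [[s Ss]|noS] := pselect (exists s, S s); last first.
    by exists None; rewrite /= -subset0 => s Ss; apply: noS; exists s.
  have exS : exists s, `[< S s >] by exists s; apply/asboolP.
  case: (ex_minnP exS) => m /asboolP Sm minm.
  by exists (Some m); split=> // t /asboolP /minm.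
pose nxt s := projT1 (cid (minP (trigger_set sigma1 x s))).
have nxtP s : is_min (trigger_set sigma1 x s) (nxt s).
  by rewrite /nxt; case: cid.
pose tau := fix tau k := if k is j.+1 then nxt (tau j) else Some 0%N.
have tauS k : tau k.+1 = nxt (tau k) by [].
exists x, xhat, (fun t => K *m xhat t), tau; split=> //.
have hold s t : xhat s = x s -> (s <= t)%N -> before t (nxt (Some s)) ->
    xhat t = x s.
  move=> xs; elim: t => [|t IHt]; first by rewrite leqn0 => /eqP s0 _; rewrite -xs s0.
  rewrite leq_eqVlt => /predU1P[<- //|]; rewrite ltnS => st bt.
  have bt' : before t (nxt (Some s)).
    by move: bt; case: (nxt _) => //= m; apply: ltn_trans.
  rewrite xhatS (IHt st bt'); case: ifP => // trig.
  have St : trigger_set sigma1 x (Some s) t.+1 by split.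
  have := nxtP (Some s); move: bt; case: (nxt _) => [m /= mt [_ /(_ _ St)]|_ /=].
    by rewrite leqNgt mt.
  by move=> S0; move: St; rewrite S0.
move=> k tk t tauk; rewrite tauS tauk; apply: (hold tk t).
elim: k tk tauk => [_ [<-] //|k IHk tk]; rewrite tauS.
have := nxtP (tau k); case tauk: (tau k) => [s|] => [|+ nxtk]; last first.
  by rewrite nxtk /= => -[].
move=> + nxtk; rewrite nxtk /= => -[[stk trig] mintk].
case: tk stk trig nxtk mintk => // t' st trig nxtk mintk.
by rewrite xhatS (hold s) ?trig//; [exact: IHk|rewrite nxtk /=].
Qed.

Lemma event_triggered_loop_causal {R : realType} {nx nu nw : nat}
    (A : 'M[R]_nx) (B : 'M[R]_(nx, nu)) (E : 'M[R]_(nx, nw))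
    (K : 'M[R]_(nu, nx)) (sigma1 : R) (x0 : 'cV[R]_nx)
    (w w' : nat -> 'cV[R]_nw) x xhat u tau x' xhat' u' tau' (t : nat) :
  event_triggered_loop A B E K sigma1 x0 w x xhat u tau ->
  event_triggered_loop A B E K sigma1 x0 w' x' xhat' u' tau' ->
  (forall s, (s < t)%N -> w s = w' s) -> x t = x' t.
Proof.
have rec v y yhat c sg : event_triggered_loop A B E K sigma1 x0 v y yhat c sg ->
    yhat 0%N = x0 /\ forall s, yhat s.+1 =
      if sigma1 < enorm (yhat s - y s.+1) then y s.+1 else yhat s.
  case=> y0 _ _ hold sg0 sgS.
  have cover s : exists k s', [/\ sg k = Some s', (s' <= s)%N
      & before s (sg k.+1)].
    elim: s => [|s [k [s' [sgk s's bs]]]].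
      exists 0%N, 0%N; split=> //; have := sgS 0%N; rewrite sg0.
      by case: (sg 1%N) => //= m [[]].
    have [bs1|nbs1] := boolP (before s.+1 (sg k.+1)).
      by exists k, s'; split=> //; exact: leqW.
    have sgk1 : sg k.+1 = Some s.+1.
      move: bs nbs1; case: (sg k.+1) => //= m sm; rewrite -leqNgt => ms.
      by congr Some; apply/eqP; rewrite eqn_leq ms sm.
    exists k.+1, s.+1; split=> //; have := sgS k.+1; rewrite sgk1.
    by case: (sg k.+2) => //= m [[]].
  split.
    have [k [s' [sgk]]] := cover 0%N; rewrite leqn0 => /eqP s'0 b.
    by rewrite (hold k s' 0%N sgk) ?s'0.
  move=> s; have [k [s' [sgk s's bs]]] := cover s.
  rewrite (hold _ _ _ sgk s's bs).
  have [bs1|nbs1] := boolP (before s.+1 (sg k.+1)).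
    rewrite (hold _ _ _ sgk (leqW s's) bs1); case: ifPn => // trig.
    have St : trigger_set sigma1 y (Some s') s.+1 by split.
    have := sgS k; rewrite sgk; move: bs1.
    case: (sg k.+1) => [m /= sm [_ /(_ _ St)]|_ /= S0].
      by rewrite leqNgt sm.
    by move: St; rewrite S0.
  have sgk1 : sg k.+1 = Some s.+1.
    move: bs nbs1; case: (sg k.+1) => //= m sm; rewrite -leqNgt => ms.
    by congr Some; apply/eqP; rewrite eqn_leq ms sm.
  have := sgS k; rewrite sgk sgk1 => -[[_ trig] _]; rewrite trig.
  apply: (hold k.+1) => //; have := sgS k.+1; rewrite sgk1.
  by case: (sg k.+2) => //= m [[]].
move=> H H'; have [h0 hS] := rec _ _ _ _ _ H; have [h0' hS'] := rec _ _ _ _ _ H'.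
case: H H' => [i d c _ _ _] [i' d' c' _ _ _].
suff HH : (forall s, (s < t)%N -> w s = w' s) -> x t = x' t /\ xhat t = xhat' t.
  by move=> /HH[].
elim: t => [|t IHt] ww; first by rewrite i i' h0 h0'.
have [xx hh] : x t = x' t /\ xhat t = xhat' t.
  by apply: IHt => s st; apply: ww; exact: leqW.
have xS : x t.+1 = x' t.+1 by rewrite d d' c c' xx hh ww.
by split=> //; rewrite hS hS' xS hh.
Qed.

(* Main.v *)
Require Import Defs.
From mathcomp Require Import ring lra.
Import Order.TTheory GRing.Theory Num.Theory.
Local Open Scope ring_scope.
Set Implicit Arguments.
Unset Strict Implicit.
Unset Printing Implicit Defensive.

(* Write [F = A + BK], [rho = |F|], [c = sqrt (tr P / eps)], [b = r - c], and split
   [x = d + z] into the response [z] to the noise and the response [d] to the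
   initial state and the errors [e].  Then [|d_t| <= b + rho^t |x0|] and
   [E |z_t|^2 <= tr P], so that the Euclidean triangle inequality bounds the
   worst-case CVaR of [|x_t|^2] by [(r + rho^t |x0|)^2].  When [sigma1] equals its
   bound this is not enough, as the transient never vanishes.

   What makes [r] reachable in finite time is that the triangle inequality is
   never sharp.  If [|d_t|] is close to [b], then all recent errors must have
   maximal norm, so no triggering took place, the held state is constant, and the
   recent errors, states and hence noise increments are, approximately, linear
   functions of [d_t].  These relations are incompatible with the covariance of
   the noise response: some [zeta], linear in [z_t, ..., z_(t-3)], satisfies
   [E <z_t, zeta> < 0], while [<d_t, zeta>] is nonnegative up to the square root
   of the deficit [b - |d_t|].  Splitting [x_t] as
   [(d_t - eta zeta) + (z_t + eta zeta)] then gains a term of order [eta],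
   uniformly in [t] and in the distribution, which absorbs the transient. *)

(** * Euclidean geometry of column vectors *)

Definition dotv {R : realType} {n : nat} (u v : 'cV[R]_n) : R :=
  (u^T *m v) 0 0.

Section EuclideanSpace.
Local Open Scope classical_set_scope.
Context {R : realType}.
Implicit Types m n : nat.

Lemma dotvE n (u v : 'cV[R]_n) : dotv u v = \sum_i u i 0 * v i 0.
Proof. by rewrite /dotv mxE; apply: eq_bigr => i _; rewrite mxE. Qed.

Lemma dotvC n (u v : 'cV[R]_n) : dotv u v = dotv v u.
Proof. by rewrite !dotvE; apply: eq_bigr => i _; rewrite mulrC. Qed.

Lemma dotvDr n (u v w : 'cV[R]_n) : dotv u (v + w) = dotv u v + dotv u w.
Proof. by rewrite /dotv mulmxDr mxE. Qed.

Lemma dotvDl n (u v w : 'cV[R]_n) : dotv (v + w) u = dotv v u + dotv w u.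
Proof. by rewrite dotvC dotvDr !(dotvC u). Qed.

Lemma dotvZr n a (u v : 'cV[R]_n) : dotv u (a *: v) = a * dotv u v.
Proof. by rewrite /dotv -scalemxAr mxE. Qed.

Lemma dotvZl n a (u v : 'cV[R]_n) : dotv (a *: u) v = a * dotv u v.
Proof. by rewrite dotvC dotvZr dotvC. Qed.

Lemma dotvNr n (u v : 'cV[R]_n) : dotv u (- v) = - dotv u v.
Proof. by rewrite -scaleN1r dotvZr mulN1r. Qed.

Lemma dotvNl n (u v : 'cV[R]_n) : dotv (- u) v = - dotv u v.
Proof. by rewrite dotvC dotvNr dotvC. Qed.

Lemma dotv_mulmxl m n (M : 'M[R]_(m, n)) u v :
  dotv (M *m u) v = dotv u (M^T *m v).
Proof. by rewrite /dotv trmx_mul mulmxA. Qed.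

Lemma dotv_mulmxr m n (M : 'M[R]_(m, n)) u v :
  dotv u (M *m v) = dotv (M^T *m u) v.
Proof. by rewrite dotv_mulmxl trmxK. Qed.

Lemma dotv_ge0 n (u : 'cV[R]_n) : 0 <= dotv u u.
Proof. by rewrite dotvE sumr_ge0 // => i _; rewrite -expr2 sqr_ge0. Qed.

Lemma dotv_gt0 n (u : 'cV[R]_n) : u != 0 -> 0 < dotv u u.
Proof.
move=> u0; rewrite lt0r dotv_ge0 andbT; apply: contraNneq u0.
rewrite dotvE => /eqP; rewrite psumr_eq0; last by move=> i _; rewrite -expr2 sqr_ge0.
move=> /allP u0; apply/eqP/matrixP => i j; rewrite ord1 mxE.
by have := u0 i; rewrite mem_index_enum => /(_ isT); rewrite -expr2 sqrf_eq0 => /eqP.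
Qed.

Lemma sqr_enorm n (u : 'cV[R]_n) : enorm u ^+ 2 = dotv u u.
Proof.
rewrite /enorm sqr_sqrtr; last by apply: sumr_ge0 => i _; exact: sqr_ge0.
by rewrite dotvE; apply: eq_bigr => i _; rewrite expr2.
Qed.

Lemma enorm_ge0 n (u : 'cV[R]_n) : 0 <= enorm u.
Proof. exact: sqrtr_ge0. Qed.
Hint Resolve enorm_ge0 : core.

Lemma enorm_gt0 n (u : 'cV[R]_n) : u != 0 -> 0 < enorm u.
Proof.
by move=> /dotv_gt0; rewrite -sqr_enorm !lt0r enorm_ge0 sqrf_eq0 andbT => /andP[].
Qed.

(** The form of [S] at [x u + y w] is nonnegative. The choices [(- b, a)] and [(c, - b)] give
    [a (a c - b^2) >= 0] and [c (a c - b^2) >= 0]; if [a = c = 0], the choice [(1, - b)] forces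
    [b = 0]. *)
Lemma psd_cauchy_schwarz n (S : 'M[R]_n) (u w : 'cV[R]_n) :
  S^T = S -> (forall v, 0 <= dotv (S *m v) v) ->
  dotv (S *m u) w ^+ 2 <= dotv (S *m u) u * dotv (S *m w) w.
Proof.
move=> symS psdS.
set a := dotv (S *m u) u; set c := dotv (S *m w) w; set b := dotv (S *m u) w.
have q (x y : R) : 0 <= x ^+ 2 * a + 2 * x * y * b + y ^+ 2 * c.
  have := psdS (x *: u + y *: w).
  rewrite mulmxDr -!scalemxAr !(dotvDl, dotvDr, dotvZl, dotvZr).
  rewrite (dotv_mulmxl _ w u) symS (dotvC w) -/a -/b -/c; move: a b c => a b c h; clear -h; lra.
have a0 : 0 <= a by exact: psdS.
have c0 : 0 <= c by exact: psdS.
move: a0; rewrite le_eqVlt => /predU1P[a0|a0]; last first.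
  rewrite -(ler_pM2l a0); have := q (- b) a.
  move: a b c {q c0} a0 => a b c _ h; clear -h; nra.
move: c0; rewrite le_eqVlt => /predU1P[c0|c0]; last first.
  rewrite -(ler_pM2l c0); have := q c (- b).
  move: a b c {q a0} c0 => a b c _ h; clear -h; nra.
by have := q 1 (- b); rewrite -a0 -c0; move: b {q} => b h; clear -h; nra.
Qed.

Lemma dotv_le_enorm n (u v : 'cV[R]_n) : dotv u v <= enorm u * enorm v.
Proof.
have := @psd_cauchy_schwarz n 1%:M u v (trmx1 _ _).
rewrite !mul1mx -!sqr_enorm -exprMn => CS.
have := CS (fun v => ltac:(by rewrite mul1mx; exact: dotv_ge0)).
rewrite -ler_sqrt ?sqr_ge0// !sqrtr_sqr (ger0_norm (mulr_ge0 _ _))//.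
exact/le_trans/ler_norm.
Qed.

Lemma enormN n (u : 'cV[R]_n) : enorm (- u) = enorm u.
Proof. by rewrite /enorm; under eq_bigr do rewrite mxE sqrrN. Qed.

Lemma enorm0 n : enorm (0 : 'cV[R]_n) = 0.
Proof. by rewrite /enorm big1 ?sqrtr0// => i _; rewrite mxE expr0n. Qed.

Lemma norm_dotv_le n (u v : 'cV[R]_n) : `|dotv u v| <= enorm u * enorm v.
Proof.
by rewrite ler_norml dotv_le_enorm andbT lerNl -dotvNl -(enormN u) dotv_le_enorm.
Qed.

Lemma ler_enormD n (u v : 'cV[R]_n) : enorm (u + v) <= enorm u + enorm v.
Proof.
rewrite -(@ler_pXn2r _ 2) ?nnegrE ?addr_ge0//.
rewrite sqr_enorm !(dotvDl, dotvDr) (dotvC v u) -!sqr_enorm.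
by have := dotv_le_enorm u v; nra.
Qed.

Lemma ler_enormB n (u v : 'cV[R]_n) : enorm (u - v) <= enorm u + enorm v.
Proof. by rewrite -(enormN v) ler_enormD. Qed.

Lemma enormZ n a (u : 'cV[R]_n) : enorm (a *: u) = `|a| * enorm u.
Proof.
apply/eqP; rewrite -(@eqrXn2 _ 2) ?mulr_ge0// exprMn !sqr_enorm.
by rewrite dotvZl dotvZr mulrA real_normK ?num_real ?expr2.
Qed.

(** Cauchy-Schwarz on each row, [S] being the squared Frobenius norm. This crude bound gives the
    boundedness on which the study of the spectral norm rests; the added 1 makes the constant
    positive. *)
Lemma mulmx_enorm_bounded m n (M : 'M[R]_(m, n)) :
  exists2 C, 0 < C & forall v, enorm (M *m v) <= C * enorm v.
Proof.
pose S := \sum_i dotv (row i M)^T (row i M)^T.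
have S0 : 0 <= S by apply: sumr_ge0 => i _; exact: dotv_ge0.
exists (Num.sqrt S + 1); first by rewrite ltr_wpDl ?sqrtr_ge0.
move=> v; rewrite (@le_trans _ _ (Num.sqrt S * enorm v))//; last first.
  by rewrite ler_wpM2r// lerDl.
rewrite -(@ler_pXn2r _ 2) ?nnegrE ?mulr_ge0 ?sqrtr_ge0//.
rewrite exprMn (sqr_sqrtr S0) sqr_enorm dotvE mulr_suml.
apply: ler_sum => i _.
have -> : (M *m v) i 0 = dotv (row i M)^T v.
  by rewrite /dotv trmxK -row_mul [RHS]mxE.
rewrite -expr2 -sqr_enorm -exprMn -[leLHS]real_normK ?num_real//.
by rewrite ler_pXn2r ?nnegrE ?mulr_ge0// norm_dotv_le.
Qed.

Lemma trmx_enorm_bounded m n (M : 'M[R]_(m, n)) C : 0 <= C ->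
  (forall v, enorm (M *m v) <= C * enorm v) ->
  forall v, enorm (M^T *m v) <= C * enorm v.
Proof.
move=> C0 MC v; have [->|Mv0] := eqVneq (M^T *m v) 0.
  by rewrite enorm0 mulr_ge0.
rewrite -(ler_pM2l (enorm_gt0 Mv0)) -expr2 sqr_enorm -dotv_mulmxr.
rewrite dotvC (le_trans (dotv_le_enorm _ _))//.
by rewrite mulrA [X in _ <= X * _]mulrC ler_wpM2r.
Qed.

(** Cauchy-Schwarz for the form of [S], applied to [v] and [S^-1 v], reads
    [|v|^4 <= <S v, v> <v, S^-1 v>], and the last factor is at most [C |v|^2]. *)
Lemma psd_unitmx_coercive n (S : 'M[R]_n) : S^T = S ->
  (forall v, 0 <= dotv (S *m v) v) -> S \in unitmx ->
  exists2 c, 0 < c & forall v, c * enorm v ^+ 2 <= dotv (S *m v) v.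
Proof.
move=> symS psdS uS; have [C C0 SC] := mulmx_enorm_bounded (invmx S).
exists C^-1; first by rewrite invr_gt0.
move=> v; rewrite ler_pdivrMl//.
have [->|v0] := eqVneq v 0.
  by rewrite enorm0 expr0n mulr_ge0// ltW.
have := psd_cauchy_schwarz v (invmx S *m v) symS psdS.
rewrite (dotv_mulmxl S v) symS !mulKVmx// -sqr_enorm => CS.
have /(ler_wpM2l (psdS v)) := le_trans (dotv_le_enorm v (invmx S *m v))
  (ler_wpM2l (enorm_ge0 v) (SC v)).
move/(le_trans CS) => {}CS.
rewrite -(ler_pM2l (exprn_gt0 2 (enorm_gt0 v0))).
by rewrite -expr2 (le_trans CS)// le_eqVlt; apply/orP; left; apply/eqP; ring.
Qed.

(** * Singular values and the spectral norm *)

Lemma eigenvalue_nunitmx n (M : 'M[R]_n) a :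
  eigenvalue M a = (M - a%:M \notin unitmx).
Proof.
by rewrite /eigenvalue /eigenspace kermx_eq0 row_free_unit.
Qed.

(* The least [l] with [|M v|^2 <= l |v|^2] is an eigenvalue of [M^T M]:
   otherwise [l - M^T M] would be invertible, hence coercive, and [l] could be
   decreased. *)
Lemma top_singular_value m n (M : 'M[R]_(m, n)) : (0 < n)%N ->
  exists2 s, singular_value M s & forall v, enorm (M *m v) <= s * enorm v.
Proof.
move=> n0.
pose S : set R := [set l | forall v, enorm (M *m v) ^+ 2 <= l * enorm v ^+ 2].
have S0 l : S l -> 0 <= l.
  pose e : 'cV[R]_n := const_mx 1.
  have e0 : e != 0.
    apply/negP => /eqP/matrixP/(_ (Ordinal n0) 0)/eqP.
    by rewrite !mxE oner_eq0.
  move=> /(_ e); have := exprn_gt0 2 (enorm_gt0 e0).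
  by move=> e2 /(le_trans (sqr_ge0 _)); rewrite pmulr_lge0.
have infS : has_inf S.
  split; last by exists 0 => l /S0.
  have [C C0 MC] := mulmx_enorm_bounded M; exists (C ^+ 2) => v.
  by rewrite -exprMn ler_pXn2r ?nnegrE// mulr_ge0// ltW.
have Sl : S (inf S).
  move=> v; have [->|v0] := eqVneq v 0.
    by rewrite mulmx0 !enorm0 expr0n mulr0.
  have v2 := exprn_gt0 2 (enorm_gt0 v0).
  rewrite -ler_pdivrMr//; apply: lb_le_inf; first by case: infS.
  by move=> l Ml; rewrite ler_pdivrMr.
set l := inf S in Sl *; have l0 := S0 _ Sl.
exists (Num.sqrt l); last first.
  move=> v; rewrite -(@ler_pXn2r _ 2) ?nnegrE ?mulr_ge0 ?sqrtr_ge0//.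
  by rewrite exprMn (sqr_sqrtr l0); exact: Sl.
split; first exact: sqrtr_ge0.
rewrite (sqr_sqrtr l0) eigenvalue_nunitmx; apply/negP => uM.
pose D := l%:M - M^T *m M.
have uD : D \in unitmx by rewrite /D -opprB -scaleN1r unitmxZ ?unitrN1.
have Dq v : dotv (D *m v) v = l * enorm v ^+ 2 - enorm (M *m v) ^+ 2.
  rewrite mulmxBl mul_scalar_mx dotvDl dotvNl dotvZl !sqr_enorm.
  by rewrite -mulmxA (dotv_mulmxl M^T) trmxK.
have symD : D^T = D by rewrite linearB /= tr_scalar_mx trmx_mul trmxK.
have psdD v : 0 <= dotv (D *m v) v by rewrite Dq subr_ge0; exact: Sl.
have [c c0 cD] := psd_unitmx_coercive symD psdD uD.
have : S (l - c) by move=> v; have := cD v; rewrite Dq; lra.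
by move=> /(ge_inf (proj2 infS)); rewrite -/l; lra.
Qed.

(** A set without supremum has [sup] equal to 0. *)
Lemma specnorm_ge0 m n (M : 'M[R]_(m, n)) : 0 <= specnorm M.
Proof.
rewrite /specnorm; have [[s Ms]|/forallNP M0] := pselect (exists s, singular_value M s).
  have [hs|hs] := pselect (has_sup [set s | singular_value M s]).
    by apply: (le_trans (proj1 Ms)); apply: ub_le_sup => //; case: hs.
  by rewrite sup_out.
by rewrite sup_out// => -[[s /M0]].
Qed.

(** The singular value [s] with [|M v| <= s |v|] also bounds every other singular value, as an
    eigenvector of [M^T M] shows; so the supremum is over a bounded set and is at least [s]. *)
Lemma enorm_mulmx_le m n (M : 'M[R]_(m, n)) (v : 'cV[R]_n) :
  enorm (M *m v) <= specnorm M * enorm v.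
Proof.
case: n M v => [|n] M v.
  by rewrite (flatmx0 v) mulmx0 !enorm0 mulr0.
have [s Ms sM] := top_singular_value M (ltn0Sn n).
apply: (le_trans (sM v)); rewrite ler_wpM2r//; apply: ub_le_sup => //.
exists s => s' [s'0 /eigenvalueP[w Mw w0]].
have v0 : w^T != 0 by rewrite trmx_eq0.
have := sM w^T; rewrite -(@ler_pXn2r _ 2) ?nnegrE ?mulr_ge0//; last by case: Ms.
have Mw' : M^T *m (M *m w^T) = s' ^+ 2 *: w^T.
  by rewrite -linearZ /= -Mw !trmx_mul trmxK mulmxA.
rewrite exprMn sqr_enorm dotv_mulmxl Mw' dotvZr -sqr_enorm.
by rewrite ler_pM2r ?exprn_gt0 ?enorm_gt0// ler_pXn2r ?nnegrE//; case: Ms.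
Qed.

End EuclideanSpace.
#[export] Hint Extern 0 (is_true (0 <= enorm _)%R) => apply: enorm_ge0 : core.

(** * Quadratic functions of the disturbance *)

Section Expectation.
Context {R : realType} {d : measure_display} {T : measurableType d}.
Variable P : probability T R.

(* The smaller function need not be measurable: the integral of a nonnegative
   function is the supremum of those of the simple functions below it. *)
Lemma ge0_expectation_le (X Y : T -> R) :
  (forall x, 0 <= X x) -> (forall x, X x <= Y x) ->
  ('E_P[X] <= 'E_P[Y])%E.
Proof.
move=> X0 XY; rewrite unlock.
have Y0 x : 0 <= Y x by exact: le_trans (XY x).
rewrite !ge0_integralTE; [|by move=> x; rewrite lee_fin..].
apply: ereal_sup_le => _ [h /= hX <-]; exists h => //= x.
by rewrite (le_trans (hX x))// lee_fin.
Qed.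

Lemma expectation_fin_sum (I : finType) (F : I -> T -> R) :
  (forall i, F i \in Lfun P 1) ->
  (fun x => \sum_i F i x) \in Lfun P 1 /\
  ('E_P[fun x => (\sum_i F i x)%R] = \sum_i 'E_P[F i])%E.
Proof.
move=> F1.
have -> : (fun x => \sum_i F i x) = \sum_(f <- map F (index_enum I)) f.
  by rewrite big_map; apply/funext => x; rewrite fct_sumE.
split; first by rewrite big_map rpred_sum.
rewrite expectation_sum ?big_map//.
by move=> f /mapP[i _ ->].
Qed.

End Expectation.

Definition stacked {R : realType} {n : nat} (wbar : n.-tuple R) : 'cV[R]_n :=
  \col_k tnth wbar k.

Section Ambiguity.
Context {R : realType} {nw t : nat}.
Variables (Sigma : 'M[R]_nw) (P : probability ((t * nw)%N.-tuple R) R).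
Hypothesis PS : ambiguity_set Sigma t P.

Let Gamma := (1%:M : 'M[R]_t) *t Sigma.

Lemma expectation_coordM k l :
  coord k \* coord l \in Lfun P 1 /\
  ('E_P[coord k \* coord l] = (Gamma k l)%:E)%E.
Proof.
case: PS => L2 E0 cov.
have L1 i : coord i \in Lfun P 1.
  by apply: Lfun_subset12; rewrite ?L2//; exact: fin_num_measure.
have L12 := Lfun2_mul_Lfun1 (L2 k) (L2 l).
split=> //; rewrite -cov covarianceE//.
by rewrite !E0 mule0 sube0.
Qed.

(** The value depends on the second moments only, hence is the same for all distributions of the
    ambiguity set. *)
Lemma expectation_quadratic (a : R) (Q : 'M[R]_(t * nw)) :
  ('E_P[fun w => (a + dotv (stacked w) (Q *m stacked w))%R] =
   (a + \tr (Q *m Gamma))%R%:E)%E.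
Proof.
pose F (p : 'I_(t * nw) * 'I_(t * nw)) : (t * nw)%N.-tuple R -> R :=
  Q p.1 p.2 \o* (coord p.1 \* coord p.2).
have -> : (fun w => a + dotv (stacked w) (Q *m stacked w)) =
    cst a \+ (fun w => \sum_p F p w).
  apply/funext => w /=; congr (_ + _); rewrite dotvE.
  rewrite -(pair_bigA _ (fun i j => F (i, j) w)) /=.
  apply: eq_bigr => k _; rewrite !mxE mulr_sumr; apply: eq_bigr => l _.
  by rewrite mxE /F /= /coord; ring.
have FL p : F p \in Lfun P 1.
  by apply: Lfun_scale => //; case: (expectation_coordM p.1 p.2).
have EF p : ('E_P[F p] = (Q p.1 p.2 * Gamma p.1 p.2)%:E)%E.
  have [L1 Ekl] := expectation_coordM p.1 p.2.
  by rewrite /F expectationZl// Ekl.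
(* The symmetry of [Gamma] is inherited from that of the covariance under [P]. *)
have symG k l : Gamma k l = Gamma l k.
  case: PS => _ _ cov; have := covarianceC P (coord k) (coord l).
  by rewrite !cov => -[].
have [L1 EL] := expectation_fin_sum FL.
rewrite expectationD ?Lfun_cst// EL expectation_cst.
under eq_bigr do rewrite EF.
rewrite sumEFin -EFinD; congr (_ + _)%:E.
rewrite -(pair_bigA _ (fun i j => Q i j * Gamma i j)) /=.
apply: eq_bigr => k _; rewrite [RHS]mxE; apply: eq_bigr => l _.
by rewrite symG.
Qed.

End Ambiguity.

(** A certificate valid for all distributions at once: one value of [beta] bounds the infimum in the
    CVaR, and one quadratic majorant has the same expectation under each of them. The final bound is
    [beta + (- eps beta) / eps = 0]. *)
Lemma worst_case_cvar_le0 (R : realType) (nw t : nat) (Sigma : 'M[R]_nw)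
    (eps a beta : R) (Q : 'M[R]_(t * nw)) (L : (t * nw)%N.-tuple R -> R) :
  0 < eps ->
  (forall w, Num.max (L w - beta) 0 <= a + dotv (stacked w) (Q *m stacked w)) ->
  a + \tr (Q *m (1%:M *t Sigma)) <= - (eps * beta) ->
  (worst_case_cvar (ambiguity_set Sigma t) eps L <= 0)%E.
Proof.
move=> eps0 LQ Qle; apply: ge_ereal_sup => _ [P PS <-].
apply: ge_ereal_inf; exists (beta%:E + (eps^-1)%:E *
    'E_P[fun x => (Num.max (L x - beta) 0)%R])%E; first by exists beta.
have : ('E_P[fun x => (Num.max (L x - beta) 0)%R] <= (- (eps * beta))%:E)%E.
  apply: le_trans (ge0_expectation_le P _ LQ) _.
    by move=> x; rewrite le_max lexx orbT.
  by rewrite (expectation_quadratic PS) lee_fin.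
move=> /(lee_wpmul2l (_ : 0 <= (eps^-1)%:E)%E) EL.
apply: le_trans (leeD2l _ (EL _)) _; first by rewrite lee_fin invr_ge0 ltW.
by rewrite -EFinM -EFinD lee_fin mulrN mulKf ?gt_eqF// subrr.
Qed.

(** * Second moments of the linear response *)

Section Response.
Context {R : realType} {nx nw : nat}.
Variables (F P : 'M[R]_nx) (E : 'M[R]_(nx, nw)) (Sigma : 'M[R]_nw) (t : nat).

(** The matrix that extracts [w_s] from the stacked disturbance; it is zero for [s >= t]. *)
Definition block (s : nat) : 'M[R]_(nw, t * nw) :=
  \matrix_(i, k) ((k : nat) == s * nw + i)%N%:R.

(** The response to the noise as a matrix acting on the stacked disturbance, so that cross
    covariances become products [L Gamma L'^T]. *)
Fixpoint response (s : nat) : 'M[R]_(nx, t * nw) :=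
  if s is s'.+1 then F *m response s' + E *m block s' else 0.

Lemma block_mulmx (s : 'I_t) p (M : 'M[R]_(t * nw, p)) i j :
  (block s *m M) i j = M (mxtens_index (s, i)) j.
Proof.
rewrite mxE (bigD1 (mxtens_index (s, i)))//= mxE eqxx mul1r big1 ?addr0//.
by move=> k kne; rewrite mxE -[_ == _]/(k == mxtens_index (s, i)) (negPf kne) mul0r.
Qed.

Lemma block_stacked (wbar : (t * nw).-tuple R) s : (s < t)%N ->
  block s *m stacked wbar = unstack wbar s.
Proof.
move=> st; apply/colP => i.
rewrite (block_mulmx (Ordinal st)) !mxE (tnth_nth 0) //=.
Qed.

Let Gamma := (1%:M : 'M[R]_t) *t Sigma.

Lemma block_cov s s' : (s < t)%N -> (s' < t)%N ->
  block s *m Gamma *m (block s')^T = if s == s' then Sigma else 0.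
Proof.
move=> st s't; apply/matrixP => i j.
have -> : (block s *m Gamma *m (block s')^T) i j =
    (block s' *m (block s *m Gamma)^T) j i.
  by rewrite -[block s' in RHS]trmxK -trmx_mul [RHS]mxE.
rewrite (block_mulmx (Ordinal s't)) mxE (block_mulmx (Ordinal st)) tensmxE mxE.
rewrite -[Ordinal st == Ordinal s't]/(s == s').
by case: eqP; rewrite ?mul1r// mul0r mxE.
Qed.

(** Causality: the response at time [s] involves only disturbances before [s], and distinct
    disturbances are uncorrelated. *)
Lemma response_block_cov s s' : (s <= s' < t)%N ->
  response s *m Gamma *m (block s')^T = 0 /\
  block s' *m Gamma *m (response s)^T = 0.
Proof.
elim: s => [|s IHs] /andP[ss' s't] /=.
  by rewrite !mul0mx trmx0 mulmx0.
have [|L1 L2] := IHs; first by rewrite (ltnW ss').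
have st := ltn_trans ss' s't.
split.
  by rewrite !mulmxDl -!mulmxA !(mulmxA _ Gamma) L1 block_cov// ltn_eqF// !mulmx0 addr0.
rewrite linearD /= !trmx_mul mulmxDr !mulmxA L2 block_cov// gtn_eqF//.
by rewrite !mul0mx addr0.
Qed.

(** The response at [s + k] is [F^k] times the response at [s] plus later noise, which is
    uncorrelated with the response at [s]. *)
Lemma response_shift_cov s k : (s + k <= t)%N ->
  response s *m Gamma *m (response (s + k))^T =
  response s *m Gamma *m (response s)^T *m (F ^+ k)^T.
Proof.
elim: k => [|k IHk] st; first by rewrite addn0 expr0 trmx1 mulmx1.
rewrite addnS in st *; rewrite /= linearD /= !trmx_mul mulmxDr.
have [|L0 _] := @response_block_cov s (s + k); first by rewrite leq_addr.
by rewrite !mulmxA L0 IHk ?(ltnW st)// mul0mx addr0 exprS -mulmxE trmx_mul !mulmxA.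
Qed.

Hypothesis lyap : F *m P *m F^T - P + E *m Sigma *m E^T = 0.

(** [P] is the stationary covariance; the deviation from it starts at [P], because the response
    starts at 0, and is propagated by [F]. *)
Lemma response_cov s : (s <= t)%N ->
  response s *m Gamma *m (response s)^T = P - F ^+ s *m P *m (F ^+ s)^T.
Proof.
elim: s => [|s IHs] st.
  by rewrite /= !mul0mx expr0 trmx1 mul1mx mulmx1 subrr.
have [|L1 L2] := @response_block_cov s s; first by rewrite leqnn.
have ES : E *m Sigma *m E^T = P - F *m P *m F^T.
  by apply/eqP; rewrite -subr_eq0 -lyap; apply/eqP; rewrite opprB addrC; congr (_ + _).
set L := response s in L1 L2 IHs *; set J := block s in L1 L2 *.
have JJ : J *m Gamma *m J^T = Sigma by rewrite block_cov// eqxx.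
have -> : response s.+1 *m Gamma *m (response s.+1)^T =
    F *m (L *m Gamma *m L^T) *m F^T + F *m (L *m Gamma *m J^T) *m E^T +
    (E *m (J *m Gamma *m L^T) *m F^T + E *m (J *m Gamma *m J^T) *m E^T).
  by rewrite /= linearD /= !trmx_mul !(mulmxDl, mulmxDr) !mulmxA.
rewrite L1 L2 JJ IHs ?(ltnW st)// !mulmx0 !mul0mx addr0 add0r ES.
rewrite mulmxBr mulmxBl addrCA addrAC subrr sub0r exprS -mulmxE trmx_mul.
by rewrite !mulmxA.
Qed.

End Response.

(** * A direction of descent for the second moment *)

Section Descent.
Context {R : realType}.

Lemma nunitmx_left_kernel n (M : 'M[R]_n) : M \notin unitmx ->
  exists2 u : 'cV[R]_n, u != 0 & u^T *m M = 0.
Proof.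
rewrite -row_free_unit -kermx_eq0 => /rowV0Pn[v /sub_kermxP vM v0].
by exists v^T; rewrite ?trmxK// trmx_eq0.
Qed.

Lemma unitmx_inj n (M : 'M[R]_n) :
  (forall v : 'cV[R]_n, M *m v = 0 -> v = 0) -> M \in unitmx.
Proof.
move=> Minj; apply: contraT; rewrite -unitmx_tr => /nunitmx_left_kernel[u u0].
move=> /(congr1 trmx); rewrite trmx_mul !trmxK trmx0 => /Minj u00.
by rewrite u00 eqxx in u0.
Qed.

Lemma mxtrace_tr_gt0 m n (X : 'M[R]_(m, n)) : X != 0 -> 0 < \tr (X^T *m X).
Proof.
move=> X0; have -> : \tr (X^T *m X) = \sum_j dotv (col j X) (col j X).
  apply: eq_bigr => j _; rewrite mxE dotvE.
  by apply: eq_bigr => i _; rewrite !mxE.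
have [j Xj0] : exists j, col j X != 0.
  apply/existsP; apply: contraNT X0; rewrite negb_exists => /forallP X0.
  apply/eqP/matrixP => i j; have := X0 j; rewrite negbK => /eqP/colP/(_ i).
  by rewrite !mxE.
rewrite (bigD1 j)//= ltr_wpDr ?dotv_gt0//.
by apply: sumr_ge0 => i _; exact: dotv_ge0.
Qed.

Lemma mxtrace_outer n (u v : 'cV[R]_n) : \tr (u *m v^T) = dotv v u.
Proof. by rewrite mxtrace_mulC /mxtrace big_ord1. Qed.

Lemma posdefmx_unit n (P : 'M[R]_n) : posdefmx P -> P \in unitmx.
Proof.
case=> _ Ppd; apply: unitmx_inj => v Pv; apply/eqP; apply: contraT => /Ppd.
by rewrite -mulmxA Pv mulmx0 mxE ltxx.
Qed.

Lemma posdefmx_trace_gt0 n (P : 'M[R]_n) : (0 < n)%N -> posdefmx P -> 0 < \tr P.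
Proof.
case: n P => // n P _ [_ Ppd].
have diag i : 0 < P i i.
  pose e : 'cV[R]_n.+1 := delta_mx i 0.
  have /Ppd : e != 0.
    by apply/negP => /eqP/matrixP/(_ i 0)/eqP; rewrite !mxE !eqxx oner_eq0.
  by rewrite trmx_delta -rowE -colE !mxE.
rewrite /mxtrace big_ord_recl ltr_wpDr//.
by apply: sumr_ge0 => i _; apply: ltW.
Qed.

(* [P], [G1], [G2] are the limits of the covariances with [z_t] of [z_t],
   [z_(t-1) - z_(t-2)], [z_(t-2) - z_(t-3)].  If [F] and [N] are invertible and no
   such matrices existed, then [N^-1 G2 = W N^-1 G1], that is [rho X W = W X] for
   [X = N^-1 G1], whence [rho^n = 1] by taking determinants. *)
Lemma exists_descent n (F P N : 'M[R]_n) (rho : R) :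
  (0 < n)%N -> 0 < rho < 1 -> posdefmx P ->
  (forall v, enorm (F *m v) <= rho * enorm v) ->
  let W := rho^-1 *: F^T in
  let G1 := P *m F^T - P *m F^T *m F^T in
  let G2 := P *m F^T *m F^T - P *m F^T *m F^T *m F^T in
  exists S0 S1 S2 : 'M[R]_n, [/\ S0^T *m F = 0,
    S1 *m N + S2 *m (N *m W) = 0
  & \tr (S0 *m P) + \tr (S1 *m G1) + \tr (S2 *m G2) < 0].
Proof.
move=> n0 /andP[rho0 rho1] Ppd Frho W G1 G2.
have [uF|/nunitmx_left_kernel[u u0 uF]] := boolP (F \in unitmx); last first.
  (* For singular [F], take [u^T F = 0]; the trace is then [- u^T P u]. *)
  exists (- (u *m u^T)), 0, 0; split.
  - by rewrite linearN /= trmx_mul trmxK mulNmx -mulmxA uF mulmx0 oppr0.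
  - by rewrite !mul0mx addr0.
  - rewrite !mul0mx !mxtrace0 !addr0 mulNmx raddfN /= oppr_lt0 -mulmxA mxtrace_mulC.
    rewrite /mxtrace big_ord1 -mulmxA mulmxA.
    by case: Ppd => _ /(_ u u0).
have G1E : G1 = P *m F^T *m (1%:M - F^T) by rewrite mulmxBr mulmx1.
have G2E : G2 = G1 *m F^T by rewrite mulmxBl.
(* A fixed vector of [F^T] would contradict the contraction factor [rho < 1]. *)
have u1F : 1%:M - F^T \in unitmx.
  apply: unitmx_inj => v; rewrite mulmxBl mul1mx => /eqP; rewrite subr_eq0 => /eqP vF.
  have := trmx_enorm_bounded (ltW rho0) Frho v; rewrite -vF => vle.
  apply/eqP; apply: contraT => /enorm_gt0 v0.
  by have := ltr_pM2r v0 rho 1; rewrite rho1 mul1r ltNge vle.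
have uG1 : G1 \in unitmx.
  by rewrite G1E !unitmx_mul unitmx_tr uF u1F posdefmx_unit.
have [uN|/nunitmx_left_kernel[u u0 uN]] := boolP (N \in unitmx); last first.
  (* For singular [N], take [u^T N = 0]; the trace is then [- |G1^T u|^2]. *)
  exists 0, (- (G1^T *m u *m u^T)), 0; split.
  - by rewrite trmx0 mul0mx.
  - by rewrite mul0mx addr0 mulNmx -(mulmxA _ u^T) uN mulmx0 oppr0.
  - rewrite !mul0mx !mxtrace0 add0r addr0 mulNmx raddfN /= oppr_lt0.
    rewrite -(mulmxA _ u^T) -[u^T *m G1]trmxK trmx_mul trmxK mxtrace_outer dotv_gt0//.
    apply: contra_neq u0 => /(congr1 (mulmx (invmx G1^T))).
    by rewrite mulKmx ?unitmx_tr// mulmx0.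
pose X := invmx N *m G2 - W *m (invmx N *m G1).
have X0 : X != 0.
  rewrite subr_eq0; apply/eqP => /(congr1 determinant).
  have dF : \det F^T != 0 by rewrite -unitfE -unitmxE unitmx_tr.
  have dN : \det (invmx N *m G1) != 0.
    by rewrite -unitfE -unitmxE unitmx_mul unitmx_inv uN uG1.
  rewrite G2E mulmxA [LHS]det_mulmx [RHS]det_mulmx mulrC => /(mulIf dN).
  rewrite detZ -[LHS]mul1r => /(mulIf dF)/eqP.
  by rewrite lt_eqF// exprn_egt1 ?invf_gt1// -lt0n.
(* With these matrices [S1 G1 + S2 G2 = X^T (W N^-1 G1 - N^-1 G2) = - X^T X], whose trace is
   negative as [X] is nonzero. *)
exists 0, (X^T *m W *m invmx N), (- (X^T *m invmx N)); split.
- by rewrite trmx0 mul0mx.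
- by rewrite mulmxKV// mulNmx !mulmxA mulmxKV// subrr.
- have -> : X^T *m W *m invmx N *m G1 = X^T *m (W *m (invmx N *m G1)).
    by rewrite !mulmxA.
  rewrite mul0mx mxtrace0 add0r mulNmx raddfN /= -(mulmxA X^T) -raddfB /=.
  by rewrite -mulmxBr -opprB mulmxN raddfN /= oppr_lt0 mxtrace_tr_gt0.
Qed.

End Descent.

(** * The event-triggered loop *)

(** All that the bounds use of the triggering rule: at each step the held state is either refreshed,
    or kept with an error within the threshold. The triggering times disappear from here on. *)
Lemma event_triggered_xhat {R : realType} {nx nu nw : nat}
    (A : 'M[R]_nx) (B : 'M[R]_(nx, nu)) (E : 'M[R]_(nx, nw))
    (K : 'M[R]_(nu, nx)) (sigma1 : R) (x0 : 'cV[R]_nx) (w : nat -> 'cV[R]_nw)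
    x xhat u tau :
  event_triggered_loop A B E K sigma1 x0 w x xhat u tau ->
  xhat 0%N = x 0%N /\ forall s, xhat s.+1 = x s.+1 \/
    xhat s.+1 = xhat s /\ enorm (xhat s - x s.+1) <= sigma1.
Proof.
case=> _ _ _ hold tau0 tauS.
have tau_before k s : tau k = Some s -> before s (tau k.+1).
  by move=> tauk; have := tauS k; rewrite tauk; case: (tau k.+1) => //= m [[]].
(* Either [s + 1] is a triggering time, or [s] and [s + 1] lie in the same interval between
   triggering times. *)
have next s : (exists k, tau k = Some s.+1) \/
    exists k s', [/\ tau k = Some s', (s' <= s)%N & before s.+1 (tau k.+1)].
  elim: s => [|s [[k tauk]|[k [s' [tauk s's bs]]]]].
  - have := tau_before _ _ tau0; case tau1: (tau 1%N) => [[|[|m]]|] // _.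
    + by left; exists 1%N.
    + by right; exists 0%N, 0%N; rewrite tau1.
    + by right; exists 0%N, 0%N; rewrite tau1.
  - have := tau_before _ _ tauk; case tauk1: (tau k.+1) => [m|] /= => [|_].
      rewrite leq_eqVlt => /predU1P[sm|sm]; first by left; exists k.+1; rewrite sm.
      by right; exists k, s.+1; rewrite tauk1.
    by right; exists k, s.+1; rewrite tauk1.
  - move: bs; case tauk1: (tau k.+1) => [m|] /= => [|_].
      rewrite leq_eqVlt => /predU1P[sm|sm]; first by left; exists k.+1; rewrite sm.
      by right; exists k, s'; rewrite tauk1 leqW.
    by right; exists k, s'; rewrite tauk1 leqW.
split; first by apply: (hold 0%N) => //; exact: tau_before.
move=> s; have [[k tauk]|[k [s' [tauk s's bs]]]] := next s.
  by left; apply: (hold k) => //; exact: tau_before.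
have bs' : before s (tau k.+1) by case: (tau k.+1) bs => //= m /ltnW.
rewrite (hold k s' _ tauk (leqW s's) bs) (hold k s' _ tauk s's bs').
right; split=> //; rewrite leNgt; apply/negP => trig.
have := tauS k; rewrite tauk; case: (tau k.+1) bs => [m /= sm [_]|_ /= S0].
  by move=> /(_ s.+1 (conj (s's : (s' < s.+1)%N) trig)); rewrite leqNgt sm.
have : trigger_set sigma1 x (Some s') s.+1 by split.
by rewrite S0.
Qed.

(** * Extremal deterministic parts *)

(** For [d' = F d + B e], this is used with [x = |d|], [y = |d'|] and [g = <F d, d'>]: the left side
    dominates both [|rho d - F^T d'|^2] and [|rho d' - F d|^2], and [q^2] measures how far [|d'|] is
    from [b]. *)
Lemma state_deficit {R : realFieldType} (rho b q Q x y g : R) :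
  0 < rho < 1 -> 0 < b -> 0 <= q <= Q ->
  b - q ^+ 2 <= y -> 0 <= x <= b + q ^+ 2 -> y ^+ 2 - (1 - rho) * b * y <= g ->
  rho ^+ 2 * x ^+ 2 - 2 * rho * g + rho ^+ 2 * y ^+ 2 <= (4 * b + Q ^+ 2) * q ^+ 2.
Proof.
move=> /andP[rho0 rho1] b0 /andP[q0 qQ] yb /andP[x0 xb] gy.
have x2 : x ^+ 2 <= (b + q ^+ 2) ^+ 2.
  by rewrite ler_pXn2r ?nnegrE// (le_trans x0).
have q2 : q ^+ 2 <= Q ^+ 2 by rewrite ler_pXn2r ?nnegrE// (le_trans q0).
have q20 := sqr_ge0 q.
move: (q ^+ 2) (Q ^+ 2) q2 q20 x2 xb yb => p M pM p0 x2 xb yb.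
have h1 : rho ^+ 2 * x ^+ 2 <= rho ^+ 2 * (b + p) ^+ 2.
  by apply: ler_wpM2l x2; exact: sqr_ge0.
have h2 : rho * (y ^+ 2 - (1 - rho) * b * y) <= rho * g.
  by apply: ler_wpM2l gy; exact: ltW.
have h3 : rho ^+ 2 <= 1 by rewrite expr_le1 ?ltW.
have h4 : 0 <= rho * b * (y - b + p).
  by apply: mulr_ge0; [rewrite mulr_ge0 ?ltW|clear -yb; lra].
have h5 : 0 <= rho * (2 - rho) * (y - b) ^+ 2.
  by apply: mulr_ge0 (sqr_ge0 _); apply: mulr_ge0; [exact: ltW|clear -rho1; lra].
have h6 : rho ^+ 2 * (2 * b * p + p ^+ 2) <= 2 * b * p + M * p.
  apply: (@le_trans _ _ (1 * (2 * b * p + p ^+ 2))); last by nra.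
  by apply: ler_wpM2r => //; nra.
have h7 : rho * b * p <= 1 * (b * p) by rewrite -mulrA ler_wpM2r ?mulr_ge0// ltW.
rewrite -subr_ge0.
have -> : (4 * b + M) * p - (rho ^+ 2 * x ^+ 2 - 2 * rho * g + rho ^+ 2 * y ^+ 2) =
  (rho ^+ 2 * (b + p) ^+ 2 - rho ^+ 2 * x ^+ 2) +
  2 * (rho * g - rho * (y ^+ 2 - (1 - rho) * b * y)) +
  2 * (rho * b * (y - b + p)) + rho * (2 - rho) * (y - b) ^+ 2 +
  (2 * b * p + M * p - rho ^+ 2 * (2 * b * p + p ^+ 2)) +
  2 * (1 * (b * p) - rho * b * p) by ring.
by clear -h1 h2 h4 h5 h6 h7; lra.
Qed.

(** The counterpart for the error, with [x = kappa |e|] and [g = <B e, d'>]: the left side dominates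
    [|kappa e - ((1 - rho) / kappa) B^T d'|^2]. *)
Lemma error_deficit {R : realFieldType} (rho b q Q x y g : R) :
  0 < rho < 1 -> 0 < b -> 0 <= q <= Q ->
  b - q ^+ 2 <= y -> 0 <= x <= (1 - rho) * b ->
  y ^+ 2 - rho * (b + q ^+ 2) * y <= g ->
  x ^+ 2 - 2 * (1 - rho) * g + (1 - rho) ^+ 2 * y ^+ 2 <= (4 * b + Q ^+ 2) * q ^+ 2.
Proof.
move=> /andP[rho0 rho1] b0 /andP[q0 qQ] yb /andP[x0 xb] gy.
have x2 : x ^+ 2 <= ((1 - rho) * b) ^+ 2 by rewrite ler_pXn2r ?nnegrE// (le_trans x0).
have q2 : q ^+ 2 <= Q ^+ 2 by rewrite ler_pXn2r ?nnegrE// (le_trans q0).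
have q20 := sqr_ge0 q.
move: (q ^+ 2) (Q ^+ 2) q2 q20 yb gy => p M pM p0 yb gy.
have rho1' : 0 < 1 - rho by rewrite subr_gt0.
have h2 : (1 - rho) * (y ^+ 2 - rho * (b + p) * y) <= (1 - rho) * g.
  by apply: ler_wpM2l gy; exact: ltW.
have h4 : 0 <= (1 - rho) * b * (y - b + p).
  by apply: mulr_ge0; [rewrite mulr_ge0 ?ltW|clear -yb; lra].
have h5 : 0 <= (1 - rho) * (rho * (y - b - p) ^+ 2 + (y - b) ^+ 2).
  apply: mulr_ge0 (ltW rho1') _; apply: addr_ge0 (sqr_ge0 _).
  by apply: mulr_ge0 (ltW rho0) (sqr_ge0 _).
have h6 : 2 * (1 - rho) * b * p + (1 - rho) * rho * (2 * b * p + p ^+ 2) <=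
    2 * b * p + 2 * b * p + M * p.
  have bp : 0 <= b * p by rewrite mulr_ge0// ltW.
  have pp : p ^+ 2 <= M * p by rewrite expr2; exact: ler_wpM2r pM.
  have pp0 := sqr_ge0 p.
  have rr : (1 - rho) * rho <= 1 by nra.
  have := ler_wpM2r (addr_ge0 bp bp) rr; have := ler_wpM2r pp0 rr.
  have := mulr_ge0 (ltW rho0) bp.
  by clear -pp => ? ? ?; lra.
rewrite -subr_ge0.
have -> : (4 * b + M) * p - (x ^+ 2 - 2 * (1 - rho) * g + (1 - rho) ^+ 2 * y ^+ 2) =
  (((1 - rho) * b) ^+ 2 - x ^+ 2) +
  2 * ((1 - rho) * g - (1 - rho) * (y ^+ 2 - rho * (b + p) * y)) +
  2 * ((1 - rho) * b * (y - b + p)) +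
  (1 - rho) * (rho * (y - b - p) ^+ 2 + (y - b) ^+ 2) +
  (2 * b * p + 2 * b * p + M * p -
   (2 * (1 - rho) * b * p + (1 - rho) * rho * (2 * b * p + p ^+ 2))) by ring.
by clear -x2 h2 h4 h5 h6; lra.
Qed.

Section Extremal.
Context {R : realType} {n : nat}.
Variables (F B : 'M[R]_n) (rho kappa b : R).
Hypotheses (rho01 : 0 < rho < 1) (kappa0 : 0 < kappa) (b0 : 0 < b).
Hypothesis Frho : forall v, enorm (F *m v) <= rho * enorm v.
Hypothesis Bkappa : forall v, enorm (B *m v) <= kappa * enorm v.

Let rho0 : 0 < rho. Proof. by case/andP: rho01. Qed.
Let rho1 : rho < 1. Proof. by case/andP: rho01. Qed.

(* If [|F d + B e|] attains its maximum [b], then [d = W (F d + B e)] and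
   [e = V (F d + B e)].  Along an extremal trajectory ending at [d0], the noise
   contribution increases by [N d0] in the last but one step as long as the
   controller holds the same state. *)
Let W := rho^-1 *: F^T.
Let V := ((1 - rho) / kappa ^+ 2) *: B^T.
Let N := (V + W) *m (W - 1%:M).

(** The ball of radius [b] is invariant because [rho b + (1 - rho) b = b]. In this section [B] plays
    the part of the product [B K] of the closed loop. *)
Lemma enorm_step d e p : enorm d <= b + p -> 0 <= p ->
  kappa * enorm e <= (1 - rho) * b -> enorm (F *m d + B *m e) <= b + p.
Proof.
move=> db p0 eb; apply: (le_trans (ler_enormD _ _)).
have Fd := le_trans (Frho d) (ler_wpM2l (ltW rho0) db).
have Be := le_trans (Bkappa e) eb.
have : rho * p <= 1 * p by rewrite ler_wpM2r// ltW.
by lra.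
Qed.

(** Stability of the equality case of the triangle and Cauchy-Schwarz inequalities: a deficit [q^2]
    in norm makes squared distances of order [q^2], hence distances of order [q]. The last bound
    passes the deficit on to [d], so that the argument can be iterated backwards in time. *)
Lemma step_extremal Q : exists2 k, 0 < k & forall d e q,
  0 <= q <= Q -> enorm d <= b + q ^+ 2 -> kappa * enorm e <= (1 - rho) * b ->
  b - q ^+ 2 <= enorm (F *m d + B *m e) ->
  let d' := F *m d + B *m e in
  [/\ enorm (d - W *m d') <= k * q, enorm (e - V *m d') <= k * q,
      enorm (rho *: d' - F *m d) <= k * q & b - (q / rho) ^+ 2 <= enorm d].
Proof.
(* Taking [k >= 1] gives [k <= k^2], so [k] also serves after square roots are taken. *)
pose k := 4 * b + Q ^+ 2 + 1.
have k4 : 0 <= 4 * b + Q ^+ 2 by rewrite addr_ge0 ?sqr_ge0// mulr_ge0// ltW.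
have k1 : 1 <= k by rewrite lerDr.
have kQ : 4 * b + Q ^+ 2 <= k by rewrite lerDl.
move: k k1 kQ => k k1 kQ.
have k0 : 0 < k by exact: lt_le_trans k1.
have sqrt_bound s q : 0 <= q -> 0 <= s ->
    s ^+ 2 <= (4 * b + Q ^+ 2) * q ^+ 2 -> s <= k * q.
  move=> q0 s0 sk; rewrite -(@ler_pXn2r _ 2) ?nnegrE ?mulr_ge0 ?(ltW k0)//.
  rewrite (le_trans sk)// exprMn ler_wpM2r ?sqr_ge0// (le_trans kQ)//.
  by rewrite expr2 ler_peMr// ltW.
exists (k / rho + k / kappa + k).
  by rewrite !addr_gt0 ?divr_gt0.
move=> d e q /andP[q0 qQ] db eb d'b d'; rewrite -/d' in d'b.
have sqr_le c (u v : 'cV[R]_n) : 0 <= c ->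
    enorm u <= c * enorm v -> enorm u ^+ 2 <= c ^+ 2 * enorm v ^+ 2.
  by move=> c0 uv; rewrite -exprMn ler_pXn2r ?nnegrE ?mulr_ge0//.
have kq : 0 <= k * q by rewrite mulr_ge0// ltW.
have kr : 0 <= k / rho * q by rewrite mulr_ge0// divr_ge0// ltW.
have kk : 0 <= k / kappa * q by rewrite mulr_ge0// divr_ge0// ltW.
have d'd' : enorm d' ^+ 2 = dotv (F *m d) d' + dotv (B *m e) d'.
  by rewrite sqr_enorm -dotvDl.
have d'le : enorm d' <= rho * enorm d + (1 - rho) * b.
  by rewrite (le_trans (ler_enormD _ _))// lerD// (le_trans (Bkappa e)).
move: d' d'b d'd' d'le => d' d'b d'd' d'le.
have Fd2 : enorm (F *m d) ^+ 2 <= rho ^+ 2 * enorm d ^+ 2.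
  by apply: sqr_le (ltW rho0) (Frho d).
have F'd'2 : enorm (F^T *m d') ^+ 2 <= rho ^+ 2 * enorm d' ^+ 2.
  exact: sqr_le (ltW rho0) (trmx_enorm_bounded (ltW rho0) Frho _).
have B'd'2 : enorm (B^T *m d') ^+ 2 <= kappa ^+ 2 * enorm d' ^+ 2.
  exact: sqr_le (ltW kappa0) (trmx_enorm_bounded (ltW kappa0) Bkappa _).
have Bed' : dotv (B *m e) d' <= (1 - rho) * b * enorm d'.
  by rewrite (le_trans (dotv_le_enorm _ _))// ler_wpM2r// (le_trans (Bkappa e)).
have Fdd' : dotv (F *m d) d' <= rho * (b + q ^+ 2) * enorm d'.
  rewrite (le_trans (dotv_le_enorm _ _))// ler_wpM2r// (le_trans (Frho d))//.
  by rewrite ler_pM2l.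
have D1 := @state_deficit R rho b q Q (enorm d) (enorm d') (dotv (F *m d) d')
  rho01 b0.
have {}D1 : rho ^+ 2 * enorm d ^+ 2 - 2 * rho * dotv (F *m d) d' +
    rho ^+ 2 * enorm d' ^+ 2 <= (4 * b + Q ^+ 2) * q ^+ 2.
  by apply: D1; rewrite ?q0 ?enorm_ge0//; lra.
have D2 := @error_deficit R rho b q Q (kappa * enorm e) (enorm d')
  (dotv (B *m e) d') rho01 b0.
have {}D2 : (kappa * enorm e) ^+ 2 - 2 * (1 - rho) * dotv (B *m e) d' +
    (1 - rho) ^+ 2 * enorm d' ^+ 2 <= (4 * b + Q ^+ 2) * q ^+ 2.
  by apply: D2; rewrite ?q0 ?mulr_ge0 ?enorm_ge0 ?(ltW kappa0)//; lra.
split.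
- have -> : d - W *m d' = rho^-1 *: (rho *: d - F^T *m d').
    by rewrite scalerBr scalerA mulVf ?gt_eqF// scale1r -scalemxAl.
  rewrite enormZ gtr0_norm ?invr_gt0//.
  have : enorm (rho *: d - F^T *m d') <= k * q.
    apply: sqrt_bound => //; apply: le_trans D1.
    rewrite [leLHS]sqr_enorm !(dotvDl, dotvDr, dotvNl, dotvNr, dotvZl, dotvZr).
    rewrite (dotvC (F^T *m d')) !(dotv_mulmxr _ d) trmxK -!sqr_enorm.
    by lra.
  rewrite -(ler_pM2l (_ : 0 < rho^-1)) ?invr_gt0// => /le_trans; apply.
  by lra.
- have -> : e - V *m d' = kappa^-1 *: (kappa *: e - ((1 - rho) / kappa) *: (B^T *m d')).
    rewrite scalerBr !scalerA mulVf ?gt_eqF// scale1r -scalemxAl.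
    by congr (_ - _ *: _); rewrite mulrCA -expr2 exprVn.
  rewrite enormZ gtr0_norm ?invr_gt0//.
  have : enorm (kappa *: e - ((1 - rho) / kappa) *: (B^T *m d')) <= k * q.
    apply: sqrt_bound => //; apply: le_trans D2.
    rewrite [leLHS]sqr_enorm !(dotvDl, dotvDr, dotvNl, dotvNr, dotvZl, dotvZr).
    rewrite (dotvC (B^T *m d')) !(dotv_mulmxr _ e) trmxK -!sqr_enorm.
    have K2 : ((1 - rho) / kappa) ^+ 2 * enorm (B^T *m d') ^+ 2 <=
        (1 - rho) ^+ 2 * enorm d' ^+ 2.
      rewrite exprMn -mulrA ler_wpM2l ?sqr_ge0// exprVn ler_pdivrMl ?exprn_gt0//.
    have KK : kappa * ((1 - rho) / kappa) = 1 - rho.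
      by rewrite mulrCA divff ?mulr1// gt_eqF.
    rewrite exprMn; move: (enorm e) (dotv _ _) (enorm d') (enorm (B^T *m d')) K2 KK.
    move: ((1 - rho) / kappa) => z E g D G K2 KK.
    have zg : kappa * (z * g) = (1 - rho) * g by rewrite mulrA KK.
    by lra.
  rewrite -(ler_pM2l (_ : 0 < kappa^-1)) ?invr_gt0// => /le_trans; apply.
  by lra.
- apply: (@le_trans _ _ (k * q)); last by lra.
  apply: sqrt_bound => //; apply: le_trans D1.
  rewrite [leLHS]sqr_enorm !(dotvDl, dotvDr, dotvNl, dotvNr, dotvZl, dotvZr).
  rewrite (dotvC d') -!sqr_enorm.
  by lra.
(* From [|d'| <= rho |d| + (1 - rho) b], the deficit of [d] is at most [q^2 / rho], hence at most
   [(q / rho)^2]. *)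
- have : b - q ^+ 2 <= rho * enorm d + (1 - rho) * b.
    exact: le_trans d'le.
  have qq : rho * q ^+ 2 <= q ^+ 2 by rewrite ler_piMl ?sqr_ge0// ltW.
  move=> dq; rewrite -(ler_pM2l rho0) mulrBr expr_div_n.
  have -> : rho * (q ^+ 2 / rho ^+ 2) = q ^+ 2 / rho.
    by field; rewrite gt_eqF.
  have : q ^+ 2 <= q ^+ 2 / rho by rewrite ler_pdivlMr// mulrC.
  by lra.
Qed.

(** [D] is the increment of the noise response. While the state is held, [x + e] is constant, so
    [D = (e2 - e1) - (d1 - d2)], and two backward uses of [step_extremal] express this through [d0].
    The factor [1 + |D|] makes room for the case of a triggering. *)
Lemma increment_extremal Q : 0 <= Q -> exists2 k, 0 < k &
  forall d2 e2 e1 x2 x1 q, 0 <= q <= Q -> enorm d2 <= b + q ^+ 2 ->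
  kappa * enorm e2 <= (1 - rho) * b -> kappa * enorm e1 <= (1 - rho) * b ->
  let d1 := F *m d2 + B *m e2 in let d0 := F *m d1 + B *m e1 in
  b - q ^+ 2 <= enorm d0 -> e1 = 0 \/ x1 + e1 = x2 + e2 ->
  forall D, D = x1 - x2 - (d1 - d2) ->
  enorm (D - N *m d0) <= k * q * (1 + enorm D).
Proof.
move=> Q0; have Qr : Q <= Q / rho by rewrite ler_pdivlMr// ler_piMr// ltW.
have [k k0 step] := step_extremal (Q / rho).
have [cV cV0 Vle] := mulmx_enorm_bounded V.
have [cW cW0 Wle] := mulmx_enorm_bounded W.
have [cN cN0 Nle] := mulmx_enorm_bounded N.
pose p := Num.sqrt ((1 - rho) * b / 2).
have p20 : 0 < (1 - rho) * b / 2 by rewrite divr_gt0// mulr_gt0// subr_gt0.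
have p0 : 0 < p by rewrite sqrtr_gt0.
pose m := 1 + cN * (b + Q ^+ 2).
have m0 : 0 < m by rewrite ltr_pwDl// mulr_ge0 ?addr_ge0 ?sqr_ge0// ltW.
pose k' := 2 * (k / rho) + (2 + cV + cW) * k.
have k'0 : 0 < k' by rewrite addr_gt0// mulr_gt0// ?divr_gt0// !addr_gt0.
exists (m / p + k'); first by rewrite addr_gt0// divr_gt0.
move=> d2 e2 e1 x2 x1 q /andP[q0 qQ] d2b e2b e1b d1 d0 d0b held D DE.
have mp : 0 <= m / p by rewrite divr_ge0 ?ltW.
have D0 : 0 <= enorm D by [].
have d1b : enorm d1 <= b + q ^+ 2 by apply: enorm_step => //; exact: sqr_ge0.
have d0b' : enorm d0 <= b + q ^+ 2 by apply: enorm_step => //; exact: sqr_ge0.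
(* After a triggering [e1 = 0], so [b - q^2 <= |d0| <= rho (b + q^2)] and [q >= p]: the deficit is
   not small, and the crude bound on [|D - N d0|] suffices. *)
have [trig|{}held] := held.
  have d0F : enorm d0 <= rho * (b + q ^+ 2).
    by rewrite /d0 trig mulmx0 addr0 (le_trans (Frho _))// ler_pM2l.
  have pq : p <= q.
    rewrite -(@ler_pXn2r _ 2) ?nnegrE ?(ltW p0)// sqr_sqrtr ?(ltW p20)//.
    have : rho * q ^+ 2 <= q ^+ 2 by rewrite ler_piMl ?sqr_ge0// ltW.
    by lra.
  have qp : 1 <= q / p by rewrite ler_pdivlMr// mul1r.
  have q2 : q ^+ 2 <= Q ^+ 2 by rewrite ler_pXn2r ?nnegrE// (le_trans q0).
  apply: (@le_trans _ _ (m * (1 + enorm D))).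
    rewrite (le_trans (ler_enormB _ _))// /m mulrDl mul1r mulrDr mulr1.
    have := le_trans (Nle d0) (ler_wpM2l (ltW cN0) (le_trans d0b' (lerD (lexx b) q2))).
    have : 0 <= cN * (b + Q ^+ 2) * enorm D.
      by rewrite !mulr_ge0 ?addr_ge0 ?sqr_ge0// ltW.
    by lra.
  rewrite ler_wpM2r ?addr_ge0//.
  have : m * 1 <= m * (q / p) by rewrite ler_pM2l.
  have : 0 <= k' * q by rewrite mulr_ge0// ltW.
  by lra.
have qQr : 0 <= q <= Q / rho by rewrite q0 (le_trans qQ).
have [a1 f1 _ d1q] := step d1 e1 q qQr d1b e1b d0b.
have qr : 0 <= q / rho <= Q / rho by rewrite divr_ge0 ?ler_pM2r ?invr_gt0 ?(ltW rho0).
have qqr : q ^+ 2 <= (q / rho) ^+ 2.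
  rewrite ler_pXn2r ?nnegrE ?divr_ge0 ?(ltW rho0)//.
  by rewrite ler_pdivlMr// ler_piMr// ltW.
have d2b' : enorm d2 <= b + (q / rho) ^+ 2 by rewrite (le_trans d2b)// lerD2l.
have [a2 f2 _ _] := step d2 e2 (q / rho) qr d2b' e2b d1q.
rewrite -/d1 -/d0 in a1 f1 a2 f2.
(* The approximations are [e2 ~ V d1], [e1 ~ V d0], [d2 ~ W d1] and [d1 ~ W d0], whence
   [D ~ (V + W) (d1 - d0) ~ N d0]. *)
have -> : D - N *m d0 = (e2 - V *m d1) - (e1 - V *m d0) + (d2 - W *m d1)
    - (d1 - W *m d0) + V *m (d1 - W *m d0) + W *m (d1 - W *m d0).
  have -> : D = e2 - e1 - (d1 - d2).
    rewrite DE; congr (_ - _); apply/eqP; rewrite subr_eq addrAC eq_sym subr_eq.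
    by rewrite eq_sym held addrC.
  rewrite /N !(mulmxBr, mulmxDl, mulmxBl, mulmxN, mulNmx, mulmx1) -!mulmxA.
  move: (V *m (W *m d0)) (W *m (W *m d0)) (V *m d0) (W *m d0) (V *m d1) (W *m d1).
  by move=> *; apply/colP => i; rewrite !mxE; ring.
have k'q : k' * q <= (m / p + k') * q * (1 + enorm D).
  rewrite -mulrA ler_pM ?(ltW k'0)// ?lerDr// ler_peMr// lerDl//.
apply: le_trans k'q.
have := Vle (d1 - W *m d0); have := ler_wpM2l (ltW cV0) a1.
have := Wle (d1 - W *m d0); have := ler_wpM2l (ltW cW0) a1.
have -> : k' * q = k * (q / rho) + k * q + k * (q / rho) + k * q
    + cV * (k * q) + cW * (k * q) by rewrite /k'; field; rewrite gt_eqF.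
move=> W1 W2 V1 V2.
do 2 (apply: le_trans (ler_enormD _ _) _; apply: lerD; last by lra).
do 3 (apply: le_trans (ler_enormD _ _) _; rewrite ?enormN; apply: lerD => //).
Qed.

(** Up to order [q], [d0] is [F d1 / rho], which [S0^T] kills, while [D1 ~ N d0] and [D2 ~ N W d0],
    so the other two terms cancel by the relation between [S1] and [S2]. *)
Lemma descent_pairing (S0 S1 S2 : 'M[R]_n) Q :
  S0^T *m F = 0 -> S1 *m N + S2 *m (N *m W) = 0 -> 0 <= Q ->
  exists2 k, 0 < k & forall d3 e3 e2 e1 x3 x2 x1 q,
  0 <= q <= Q -> enorm d3 <= b + q ^+ 2 ->
  kappa * enorm e3 <= (1 - rho) * b -> kappa * enorm e2 <= (1 - rho) * b ->
  kappa * enorm e1 <= (1 - rho) * b ->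
  let d2 := F *m d3 + B *m e3 in let d1 := F *m d2 + B *m e2 in
  let d0 := F *m d1 + B *m e1 in
  b - q ^+ 2 <= enorm d0 ->
  e1 = 0 \/ x1 + e1 = x2 + e2 -> e2 = 0 \/ x2 + e2 = x3 + e3 ->
  forall z D1 D2, D1 = x1 - x2 - (d1 - d2) -> D2 = x2 - x3 - (d2 - d3) ->
  - dotv d0 (S0 *m z + S1 *m D1 + S2 *m D2) <=
  k * q * (1 + enorm z + enorm D1 + enorm D2).
Proof.
move=> S0F SN Q0; have Qr : Q <= Q / rho by rewrite ler_pdivlMr// ler_piMr// ltW.
have Qr0 : 0 <= Q / rho by exact: le_trans Qr.
have [k k0 step] := step_extremal (Q / rho).
have [k' k'0 incr] := increment_extremal Qr0.
have [c0 c00 S0le] := mulmx_enorm_bounded S0^T.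
have [c1 c10 S1le] := mulmx_enorm_bounded S1.
have [c2 c20 S2le] := mulmx_enorm_bounded S2.
have [cN cN0 Nle] := mulmx_enorm_bounded N.
have [m m0 mQ] : exists2 m, 0 < m & b + Q ^+ 2 <= m.
  by exists (b + Q ^+ 2) => //; rewrite ltr_pwDl ?sqr_ge0.
exists (rho^-1 * (c0 * k) + m * (c1 * k' + c2 * (k' / rho + cN * k))).
  have c0k := mulr_gt0 c00 k0; have cNk := mulr_gt0 cN0 k0.
  have c1k := mulr_gt0 c10 k'0; have k'r : 0 < k' / rho by rewrite divr_gt0.
  by rewrite addr_gt0 ?mulr_gt0 ?invr_gt0// addr_gt0// mulr_gt0// addr_gt0.
move=> d3 e3 e2 e1 x3 x2 x1 q /andP[q0 qQ] d3b e3b e2b e1b d2 d1 d0 d0b.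
move=> held1 held2 z D1 D2 D1E D2E.
have d2b : enorm d2 <= b + q ^+ 2 by apply: enorm_step => //; exact: sqr_ge0.
have d1b : enorm d1 <= b + q ^+ 2 by apply: enorm_step => //; exact: sqr_ge0.
have q2 : q ^+ 2 <= Q ^+ 2 by rewrite ler_pXn2r ?nnegrE// (le_trans q0).
have d0m : enorm d0 <= m.
  rewrite (@le_trans _ _ (b + q ^+ 2))//; last by rewrite (le_trans _ mQ)// lerD2l.
  by apply: enorm_step => //; exact: sqr_ge0.
have qQr : 0 <= q <= Q / rho by rewrite q0 (le_trans qQ).
have [a1 _ r1 d1q] := step d1 e1 q qQr d1b e1b d0b.
have I1 := incr d2 e2 e1 x2 x1 q qQr d2b e2b e1b d0b held1 D1 D1E.
have qr : 0 <= q / rho <= Q / rho by rewrite divr_ge0 ?ler_pM2r ?invr_gt0 ?(ltW rho0).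
have qqr : q ^+ 2 <= (q / rho) ^+ 2.
  rewrite ler_pXn2r ?nnegrE ?divr_ge0 ?(ltW rho0)//.
  by rewrite ler_pdivlMr// ler_piMr// ltW.
have d3b' : enorm d3 <= b + (q / rho) ^+ 2 by rewrite (le_trans d3b)// lerD2l.
have I2 := incr d3 e3 e2 x3 x2 (q / rho) qr d3b' e3b e2b d1q held2 D2 D2E.
rewrite -/d1 -/d0 -/d2 in a1 r1 I1 I2 d1q d0b.
move: d2 d1 d0 D1E D2E d2b d1b d0m a1 r1 I1 I2 d1q d0b => d2 d1 d0 D1E D2E.
move=> d2b d1b d0m a1 r1 I1 I2 d1q d0b.
pose Z := 1 + enorm z + enorm D1 + enorm D2.
have z0 : 0 <= enorm z by []. have D10 : 0 <= enorm D1 by [].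
have D20 : 0 <= enorm D2 by [].
have [zZ D1Z D2Z oneZ] : [/\ enorm z <= Z, 1 + enorm D1 <= Z, 1 + enorm D2 <= Z & 1 <= Z].
  by rewrite /Z; split; lra.
rewrite -/Z; move: Z zZ D1Z D2Z oneZ => Z zZ D1Z D2Z oneZ.
have kq0 : 0 <= k * q by rewrite mulr_ge0// ltW.
have k'q0 : 0 <= k' * q by rewrite mulr_ge0// ltW.
have J1 : enorm (D1 - N *m d0) <= k' * q * Z.
  by rewrite (le_trans I1)// ler_wpM2l.
have J2 : enorm (D2 - N *m (W *m d0)) <= (k' / rho + cN * k) * q * Z.
  have -> : D2 - N *m (W *m d0) = (D2 - N *m d1) + N *m (d1 - W *m d0).
    by rewrite mulmxBr addrA subrK.
  rewrite (le_trans (ler_enormD _ _))// !mulrDl lerD//.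
    rewrite (le_trans I2)// [k' * (q / rho)]mulrA [k' * q / rho]mulrAC.
    by rewrite ler_wpM2l// mulrAC divr_ge0// ltW.
  rewrite (le_trans (Nle _))// -!mulrA ler_pM2l// (le_trans a1)// mulrA.
  by rewrite ler_peMr.
have J0 : enorm (S0^T *m d0) <= rho^-1 * (c0 * k) * q.
  have -> : S0^T *m d0 = rho^-1 *: (S0^T *m (rho *: d0 - F *m d1)).
    rewrite mulmxBr mulmxA S0F mul0mx subr0 -scalemxAr scalerA mulVf ?scale1r//.
    by rewrite gt_eqF.
  rewrite enormZ gtr0_norm ?invr_gt0// -!mulrA ler_pM2l ?invr_gt0//.
  by rewrite (le_trans (S0le _))// ler_pM2l.
have SE : S0 *m z + S1 *m D1 + S2 *m D2 =
    S0 *m z + S1 *m (D1 - N *m d0) + S2 *m (D2 - N *m (W *m d0)).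
  have SN0 : S1 *m (N *m d0) + S2 *m (N *m (W *m d0)) = 0.
    rewrite [S1 *m _]mulmxA [N *m (W *m d0)]mulmxA [S2 *m _]mulmxA.
    by rewrite -mulmxDl SN mul0mx.
  have -> : S2 *m (D2 - N *m (W *m d0)) = S2 *m D2 + S1 *m (N *m d0).
    by rewrite mulmxBr; congr (_ + _); apply/eqP; rewrite eqr_oppLR -addr_eq0 addrC SN0.
  by rewrite mulmxBr (addrA (S0 *m z)) [RHS]addrACA addNr addr0.
rewrite SE !dotvDr dotv_mulmxr !opprD.
have pair0 : - dotv (S0^T *m d0) z <= rho^-1 * (c0 * k) * q * Z.
  rewrite -dotvNl (le_trans (dotv_le_enorm _ _))// enormN ler_pM//.
have pair1 c M (y : 'cV[R]_n) w : (forall v, enorm (M *m v) <= c * enorm v) ->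
    0 < c -> enorm y <= w -> - dotv d0 (M *m y) <= m * (c * w).
  move=> Mle c_gt0 yw; rewrite -dotvNr (le_trans (dotv_le_enorm _ _))// enormN.
  by rewrite ler_pM// (le_trans (Mle _))// ler_pM2l.
have := pair1 _ _ _ _ S1le c10 J1; have := pair1 _ _ _ _ S2le c20 J2.
by move=> ? ?; lra.
Qed.

(** The weights are tuned to [|u| = c] and [|v| = b], where the bound is [(b + c)^2]. *)
Lemma enorm_sqrD_weighted (c : R) (u v : 'cV[R]_n) : 0 < c ->
  enorm (u + v) ^+ 2 <=
  (b + c) / c * enorm u ^+ 2 + (b + c) / b * enorm v ^+ 2.
Proof.
move=> c0; apply: (@le_trans _ _ ((enorm u + enorm v) ^+ 2)).
  by rewrite ler_pXn2r ?nnegrE ?addr_ge0// ler_enormD.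
rewrite -subr_ge0.
have -> : (b + c) / c * enorm u ^+ 2 + (b + c) / b * enorm v ^+ 2 -
    (enorm u + enorm v) ^+ 2 = (b * enorm u - c * enorm v) ^+ 2 / (b * c).
  by field; rewrite !gt_eqF.
by rewrite divr_ge0 ?sqr_ge0// mulr_ge0// ltW.
Qed.

(* The cross term in [|d0 - eta zeta|^2] is absorbed by the deficit
   [q^2 = b + 2 theta - |d0|] of the deterministic part, up to [O(eta^2)]. *)
Lemma perturbed_bound (S0 S1 S2 : 'M[R]_n) (c Theta : R) :
  S0^T *m F = 0 -> S1 *m N + S2 *m (N *m W) = 0 -> 0 < c -> 0 <= Theta ->
  exists2 k, 0 < k & forall d3 e3 e2 e1 x3 x2 x1 theta eta,
  0 <= theta <= Theta -> 0 <= eta -> enorm d3 <= b + theta ->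
  kappa * enorm e3 <= (1 - rho) * b -> kappa * enorm e2 <= (1 - rho) * b ->
  kappa * enorm e1 <= (1 - rho) * b ->
  let d2 := F *m d3 + B *m e3 in let d1 := F *m d2 + B *m e2 in
  let d0 := F *m d1 + B *m e1 in
  e1 = 0 \/ x1 + e1 = x2 + e2 -> e2 = 0 \/ x2 + e2 = x3 + e3 ->
  forall z D1 D2, D1 = x1 - x2 - (d1 - d2) -> D2 = x2 - x3 - (d2 - d3) ->
  enorm (d0 + z) ^+ 2 <=
  (b + c) / c * enorm (z + eta *: (S0 *m z + S1 *m D1 + S2 *m D2)) ^+ 2 +
  (b + c) * b + k * theta +
  k * eta ^+ 2 * (1 + enorm z ^+ 2 + enorm D1 ^+ 2 + enorm D2 ^+ 2).
Proof.
move=> S0F SN c0 Theta0.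
pose Q := Num.sqrt (b + 2 * Theta).
have bT : 0 <= b + 2 * Theta by rewrite addr_ge0 ?mulr_ge0// ltW.
have Q0 : 0 <= Q by exact: sqrtr_ge0.
have [k k0 pairing] := descent_pairing S0F SN Q0.
have [c1 c10 S0le] := mulmx_enorm_bounded S0.
have [c2 c20 S1le] := mulmx_enorm_bounded S1.
have [c3 c30 S2le] := mulmx_enorm_bounded S2.
pose h := c1 + c2 + c3.
have h0 : 0 < h by rewrite /h !addr_gt0.
pose l := 4 * b + 4 * Theta + 4 * (k ^+ 2 / b + h ^+ 2).
have l1 : 4 * b + 4 * Theta <= l.
  by rewrite lerDl mulr_ge0// addr_ge0 ?sqr_ge0// divr_ge0 ?sqr_ge0// ltW.
have l2 : 4 * (k ^+ 2 / b + h ^+ 2) <= l.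
  by rewrite lerDr addr_ge0// mulr_ge0// ltW.
have l0 : 0 < l by rewrite (lt_le_trans _ l1)// ltr_pwDl ?mulr_gt0 ?mulr_ge0.
have bcb : 0 < (b + c) / b by rewrite divr_gt0// addr_gt0.
exists ((b + c) / b * l); first by rewrite mulr_gt0.
move=> d3 e3 e2 e1 x3 x2 x1 theta eta /andP[theta0 thetaT] eta0 d3b e3b e2b e1b.
move=> d2 d1 d0 held1 held2 z D1 D2 D1E D2E.
have d0b : enorm d0 <= b + theta by rewrite /d0 /d1 /d2; do 3 apply: enorm_step => //.
(* The slack [2 theta], rather than [theta], gives [q^2 >= theta], so that one [q] serves for the
   upper bound on [|d3|] and the lower bound on [|d0|]. *)
set q := Num.sqrt (b + 2 * theta - enorm d0).
have q2 : q ^+ 2 = b + 2 * theta - enorm d0.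
  by rewrite sqr_sqrtr// subr_ge0 (le_trans d0b)// lerD2l; lra.
have q0 : 0 <= q by exact: sqrtr_ge0.
have qQ : q <= Q.
  by rewrite ler_wsqrtr// lerBlDr (le_trans (_ : _ <= b + 2 * Theta)) ?lerDl// lerD2l ler_pM2l.
have qQ' : 0 <= q <= Q by rewrite q0.
have d3q : enorm d3 <= b + q ^+ 2 by rewrite (le_trans d3b)// lerD2l q2; lra.
have d0q : b - q ^+ 2 <= enorm d0 by rewrite q2; lra.
have := pairing d3 e3 e2 e1 x3 x2 x1 q qQ' d3q e3b e2b e1b d0q held1 held2
  z D1 D2 D1E D2E.
rewrite -/d2 -/d1 -/d0.
set zeta := S0 *m z + _ + _ => dzeta.
have -> : d0 + z = (z + eta *: zeta) + (d0 - eta *: zeta).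
  by rewrite addrACA subrr addr0 addrC.
apply: (le_trans (enorm_sqrD_weighted _ _ c0)); rewrite -!addrA lerD2l.
pose Z := 1 + enorm z + enorm D1 + enorm D2.
pose M := 1 + enorm z ^+ 2 + enorm D1 ^+ 2 + enorm D2 ^+ 2.
have z0 : 0 <= enorm z by []. have D10 : 0 <= enorm D1 by [].
have D20 : 0 <= enorm D2 by [].
have zetaZ : enorm zeta <= h * Z.
  apply: (le_trans (ler_enormD _ _)); apply: (@le_trans _ _ (c1 * Z + c2 * Z + c3 * Z)).
    apply: lerD.
      apply: (le_trans (ler_enormD _ _)); apply: lerD.
        by rewrite (le_trans (S0le _))// ler_pM2l// /Z; lra.
      by rewrite (le_trans (S1le _))// ler_pM2l// /Z; lra.
    by rewrite (le_trans (S2le _))// ler_pM2l// /Z; lra.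
  by rewrite /h; lra.
have Z0 : 0 <= Z by rewrite /Z !addr_ge0.
have ZM : Z ^+ 2 <= 4 * M.
  rewrite /Z /M; have := sqr_ge0 (1 - enorm z); have := sqr_ge0 (1 - enorm D1).
  have := sqr_ge0 (1 - enorm D2); have := sqr_ge0 (enorm z - enorm D1).
  have := sqr_ge0 (enorm z - enorm D2); have := sqr_ge0 (enorm D1 - enorm D2).
  by move=> ? ? ? ? ? ?; lra.
rewrite -/Z in dzeta; rewrite !addrA -/M.
have zeta2 : enorm zeta ^+ 2 <= h ^+ 2 * Z ^+ 2.
  by rewrite -exprMn ler_pXn2r ?nnegrE ?mulr_ge0// ltW.
have vE (u v : 'cV[R]_n) : enorm (u - eta *: v) ^+ 2 =
    enorm u ^+ 2 + 2 * eta * - dotv u v + eta ^+ 2 * enorm v ^+ 2.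
  rewrite sqr_enorm !(dotvDl, dotvDr, dotvNl, dotvNr, dotvZl, dotvZr).
  by rewrite (dotvC v u) -!sqr_enorm; ring.
(* The arithmetic-geometric inequality; the cost [b q^2] is repaid by the deficit of [|d0|^2] in the
   next bound. *)
have cross : 2 * eta * - dotv d0 zeta <= b * q ^+ 2 + eta ^+ 2 * (k ^+ 2 / b) * Z ^+ 2.
  have le1 : 2 * eta * - dotv d0 zeta <= 2 * eta * (k * q * Z).
    by rewrite ler_wpM2l// mulr_ge0.
  apply: (le_trans le1); rewrite -subr_ge0.
  have -> : b * q ^+ 2 + eta ^+ 2 * (k ^+ 2 / b) * Z ^+ 2 - 2 * eta * (k * q * Z)
    = (b * q - eta * k * Z) ^+ 2 / b by field; rewrite gt_eqF.
  by rewrite divr_ge0 ?sqr_ge0// ltW.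
have d02 : enorm d0 ^+ 2 <= (b + 2 * theta) ^+ 2 - b * q ^+ 2.
  have d00 : 0 <= enorm d0 by [].
  rewrite q2; move: (enorm d0) d00 d0b => y y0 yb.
  have yb2 : 0 <= b + 2 * theta - y by lra.
  have := ler_wpM2r yb2 (_ : b <= b + 2 * theta + y).
  have bs : b <= b + 2 * theta + y by lra.
  by move=> /(_ bs) ?; lra.
have v2 : enorm (d0 - eta *: zeta) ^+ 2 <= b ^+ 2 + l * theta + l * eta ^+ 2 * M.
  have e1' : eta ^+ 2 * enorm zeta ^+ 2 <= eta ^+ 2 * (h ^+ 2 * Z ^+ 2).
    by rewrite ler_wpM2l ?sqr_ge0.
  have e2' : eta ^+ 2 * (k ^+ 2 / b + h ^+ 2) * Z ^+ 2 <=
      eta ^+ 2 * (k ^+ 2 / b + h ^+ 2) * (4 * M).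
    by rewrite ler_wpM2l// mulr_ge0 ?sqr_ge0// addr_ge0 ?divr_ge0 ?sqr_ge0 ?ltW.
  have M0 : 0 <= M by rewrite /M !addr_ge0 ?sqr_ge0.
  have e3' : eta ^+ 2 * M * (4 * (k ^+ 2 / b + h ^+ 2)) <= eta ^+ 2 * M * l.
    by rewrite ler_wpM2l// mulr_ge0 ?sqr_ge0.
  have e4' : (4 * b + 4 * Theta) * theta <= l * theta by rewrite ler_wpM2r.
  have e5' : theta * theta <= Theta * theta by rewrite ler_wpM2r.
  by rewrite vE; lra.
have := ler_wpM2l (ltW bcb) v2.
have -> : (b + c) / b * (b ^+ 2 + l * theta + l * eta ^+ 2 * M) =
  (b + c) * b + (b + c) / b * l * theta + (b + c) / b * l * eta ^+ 2 * M.
  by field; rewrite gt_eqF.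
by [].
Qed.

(** Expanding [|z + eta zeta|^2] leaves a majorant that is quadratic in the noise response alone,
    with the term [eta^2 |zeta|^2] moved into the error. *)
Lemma state_bound (S0 S1 S2 : 'M[R]_n) (c Theta : R) :
  S0^T *m F = 0 -> S1 *m N + S2 *m (N *m W) = 0 -> 0 < c -> 0 <= Theta ->
  exists2 k, 0 < k & forall (d e z : nat -> 'cV[R]_n) s theta eta,
  0 <= theta <= Theta -> 0 <= eta -> enorm (d s) <= b + theta ->
  (forall i, d i.+1 = F *m d i + B *m e i) ->
  (forall i, kappa * enorm (e i) <= (1 - rho) * b) ->
  (forall i, e i.+1 = 0 \/ d i.+1 + z i.+1 + e i.+1 = d i + z i + e i) ->
  forall zeta,
  zeta = S0 *m z s.+3 + S1 *m (z s.+2 - z s.+1) + S2 *m (z s.+1 - z s) ->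
  Num.max (enorm (d s.+3 + z s.+3) ^+ 2 - (b + c) * b) 0 <=
  (b + c) / c * (enorm (z s.+3) ^+ 2 + 2 * eta * dotv (z s.+3) zeta) +
  k * theta + k * eta ^+ 2 * (1 + enorm (z s.+3) ^+ 2 + enorm (z s.+2) ^+ 2 +
                              enorm (z s.+1) ^+ 2 + enorm (z s) ^+ 2).
Proof.
move=> S0F SN c0 Theta0.
have [k k0 bound] := perturbed_bound S0F SN c0 Theta0.
have [c1 c10 S0le] := mulmx_enorm_bounded S0.
have [c2 c20 S1le] := mulmx_enorm_bounded S1.
have [c3 c30 S2le] := mulmx_enorm_bounded S2.
pose h := c1 + c2 + c3.
have h0 : 0 < h by rewrite /h !addr_gt0.
have bc0 : 0 < (b + c) / c by rewrite divr_gt0// addr_gt0.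
have K0 : 0 <= (b + c) / c * (12 * h ^+ 2).
  by rewrite mulr_ge0 ?(ltW bc0)// mulr_ge0// sqr_ge0.
exists (5 * k + (b + c) / c * (12 * h ^+ 2)).
  by rewrite ltr_pwDl// mulr_gt0.
move=> d e z s theta eta th eta0 ds dS eb held; have /andP[theta0 thetaT] := th.
have heldD i : e i.+1 = 0 \/ (d i.+1 + z i.+1) + e i.+1 = (d i + z i) + e i.
  exact: held.
have dif i : z i.+1 - z i = (d i.+1 + z i.+1) - (d i + z i) - (d i.+1 - d i).
  by apply/colP => j; rewrite !mxE; ring.
move=> zeta zetaE.
have := bound (d s) (e s) (e s.+1) (e s.+2) (d s + z s) (d s.+1 + z s.+1)
  (d s.+2 + z s.+2) theta eta th eta0 ds (eb _) (eb _) (eb _).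
rewrite /= -!dS => /(_ (heldD s.+1) (heldD s) (z s.+3) _ _ (dif s.+1) (dif s)).
rewrite -zetaE.
have expand (u v : 'cV[R]_n) : enorm (u + eta *: v) ^+ 2 =
    enorm u ^+ 2 + 2 * eta * dotv u v + eta ^+ 2 * enorm v ^+ 2.
  rewrite sqr_enorm !(dotvDl, dotvDr, dotvZl, dotvZr).
  by rewrite (dotvC v u) -!sqr_enorm; ring.
have diff2 i : enorm (z i.+1 - z i) ^+ 2 <= 2 * enorm (z i.+1) ^+ 2 + 2 * enorm (z i) ^+ 2.
  apply: (@le_trans _ _ ((enorm (z i.+1) + enorm (z i)) ^+ 2)).
    by rewrite ler_pXn2r ?nnegrE ?addr_ge0// ler_enormB.
  by have := sqr_ge0 (enorm (z i.+1) - enorm (z i)) => ?; lra.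
have zeta2 : enorm zeta ^+ 2 <= 12 * h ^+ 2 * (enorm (z s.+3) ^+ 2 +
    enorm (z s.+2) ^+ 2 + enorm (z s.+1) ^+ 2 + enorm (z s) ^+ 2).
  have zetah : enorm zeta <= h * (enorm (z s.+3) + enorm (z s.+2 - z s.+1) +
      enorm (z s.+1 - z s)).
    have a0 : 0 <= enorm (z s.+3) by [].
    have a1 : 0 <= enorm (z s.+2 - z s.+1) by [].
    have a2 : 0 <= enorm (z s.+1 - z s) by [].
    have := mulr_ge0 (ltW c10) a1; have := mulr_ge0 (ltW c10) a2.
    have := mulr_ge0 (ltW c20) a0; have := mulr_ge0 (ltW c20) a2.
    have := mulr_ge0 (ltW c30) a0; have := mulr_ge0 (ltW c30) a1.
    have := S0le (z s.+3); have := S1le (z s.+2 - z s.+1); have := S2le (z s.+1 - z s).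
    have := ler_enormD (S0 *m z s.+3) (S1 *m (z s.+2 - z s.+1)).
    have := ler_enormD (S0 *m z s.+3 + S1 *m (z s.+2 - z s.+1)) (S2 *m (z s.+1 - z s)).
    by rewrite -zetaE /h => *; lra.
  move: zetah (diff2 s.+1) (diff2 s).
  have : 0 <= enorm (z s.+2 - z s.+1) by []. have : 0 <= enorm (z s.+1 - z s) by [].
  move: (enorm (z s.+2 - z s.+1)) (enorm (z s.+1 - z s)) => D1 D2 D20 D10 zh D1z D2z.
  have a0 : 0 <= enorm (z s.+3) by [].
  apply: (@le_trans _ _ (h ^+ 2 * (enorm (z s.+3) + D1 + D2) ^+ 2)).
    by rewrite -exprMn ler_pXn2r ?nnegrE ?mulr_ge0 ?addr_ge0// ltW.
  rewrite -[leRHS]mulrA [leRHS]mulrCA ler_wpM2l ?sqr_ge0//.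
  have := sqr_ge0 (enorm (z s.+3) - D1); have := sqr_ge0 (enorm (z s.+3) - D2).
  have := sqr_ge0 (D1 - D2); have := sqr_ge0 (enorm (z s.+3)).
  have := sqr_ge0 (enorm (z s.+2)); have := sqr_ge0 (enorm (z s)).
  by move=> *; lra.
have diff2s := diff2 s; have diff2s1 := diff2 s.+1.
have sq v : 0 <= enorm (v : 'cV[R]_n) ^+ 2 by exact: sqr_ge0.
have sq0 := sq (z s); have sq1 := sq (z s.+1); have sq2 := sq (z s.+2).
have sq3 := sq (z s.+3); have sqD1 := sq (z s.+2 - z s.+1); have sqD2 := sq (z s.+1 - z s).
have sqy := sq (z s.+3 + eta *: zeta).
rewrite ge_max => xb.
set M := 1 + enorm (z s.+3) ^+ 2 + enorm (z s.+2) ^+ 2 + enorm (z s.+1) ^+ 2 +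
  enorm (z s) ^+ 2.
have eta2 := sqr_ge0 eta.
have m1 : k * eta ^+ 2 * (1 + enorm (z s.+3) ^+ 2 + enorm (z s.+2 - z s.+1) ^+ 2
    + enorm (z s.+1 - z s) ^+ 2) <= k * eta ^+ 2 * (5 * M).
  by rewrite ler_wpM2l ?mulr_ge0 ?(ltW k0)// /M; lra.
have m2 : (b + c) / c * (eta ^+ 2 * enorm zeta ^+ 2) <=
    (b + c) / c * (eta ^+ 2 * (12 * h ^+ 2 * M)).
  rewrite ler_pM2l// ler_wpM2l// (le_trans zeta2)//.
  by apply: ler_wpM2l; [rewrite mulr_ge0 ?sqr_ge0|rewrite /M; lra].
have m3 : 0 <= k * theta by rewrite mulr_ge0// ltW.
have m4 : 0 <= (b + c) / c * (12 * h ^+ 2) * theta by rewrite mulr_ge0.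
have m5 : 0 <= k * eta ^+ 2 * (1 + enorm (z s.+3) ^+ 2 +
    enorm (z s.+2 - z s.+1) ^+ 2 + enorm (z s.+1 - z s) ^+ 2).
  by rewrite !mulr_ge0 ?addr_ge0// ltW.
(* The truncation at 0 costs nothing: the majorant is nonnegative, as it contains a full square
   before expansion. *)
have m6 := mulr_ge0 (ltW bc0) sqy.
rewrite expand in xb m6.
have [g gE] : exists g, g = (b + c) / c by exists ((b + c) / c).
rewrite -gE in m2 m4 m6 xb *.
by apply/andP; split; lra.
Qed.

End Extremal.

(** * Stationary limit of the second moments *)

Section Stationary.
Context {R : realType} {n nw : nat}.
Variables (F P : 'M[R]_n) (E : 'M[R]_(n, nw)) (Sigma : 'M[R]_nw) (rho : R).
Hypotheses (rho0 : 0 <= rho) (rho1 : rho < 1).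
Hypothesis Frho : forall v, enorm (F *m v) <= rho * enorm v.
Hypothesis P_pd : posdefmx P.
Hypothesis lyap : F *m P *m F^T - P + E *m Sigma *m E^T = 0.

Lemma posdefmx_congr_trace_ge0 m (M : 'M[R]_(m, n)) : 0 <= \tr (M *m P *m M^T).
Proof.
apply: sumr_ge0 => i _.
have -> : (M *m P *m M^T) i i = ((row i M) *m P *m (row i M)^T) 0 0.
  by rewrite -row_mul mxE [RHS]mxE; apply: eq_bigr => j _; rewrite !mxE.
have [->|Mi0] := eqVneq (row i M)^T 0; first by rewrite mulmx0 mxE.
by rewrite ltW//; case: P_pd => _ /(_ _ Mi0); rewrite trmxK.
Qed.

Lemma enorm_expmx_tr s v : enorm ((F ^+ s)^T *m v) <= rho ^+ s * enorm v.
Proof.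
elim: s v => [|s IHs] v; first by rewrite !expr0 trmx1 mul1mx mul1r.
rewrite exprS -mulmxE trmx_mul -mulmxA exprSr -mulrA.
rewrite (le_trans (IHs _))// ler_wpM2l ?exprn_ge0//.
exact: trmx_enorm_bounded.
Qed.

(** The entries are [<(F^s)^T e_i, P (F^s)^T e_j>]; one factor [rho^s] is kept and the other is
    bounded by 1. *)
Lemma transient_trace_decay (X : 'M[R]_n) : exists2 k, 0 <= k & forall s,
  `|\tr (X *m (F ^+ s *m P *m (F ^+ s)^T))| <= k * rho ^+ s.
Proof.
exists (\sum_i \sum_j `|X i j| * specnorm P).
  by do 2 apply: sumr_ge0 => ? _; rewrite mulr_ge0 ?specnorm_ge0.
move=> s; have entry i j : `|(F ^+ s *m P *m (F ^+ s)^T) i j| <= specnorm P * rho ^+ s.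
  pose e k : 'cV[R]_n := delta_mx k 0.
  have e1 k : enorm (e k) = 1.
    apply/eqP; rewrite -(@eqrXn2 _ 2)// expr1n sqr_enorm /dotv.
    by rewrite trmx_delta mul_delta_mx mxE !eqxx.
  have -> : (F ^+ s *m P *m (F ^+ s)^T) i j =
      dotv ((F ^+ s)^T *m e i) (P *m ((F ^+ s)^T *m e j)).
    by rewrite dotv_mulmxl trmxK /dotv trmx_delta -rowE !mulmxA -colE !mxE.
  rewrite (le_trans (norm_dotv_le _ _))//.
  have ei := enorm_expmx_tr s (e i); have ej := enorm_expmx_tr s (e j).
  rewrite e1 mulr1 in ei; rewrite e1 mulr1 in ej.
  rewrite mulrC; apply: ler_pM => //; apply: le_trans (enorm_mulmx_le _ _) _.
  by rewrite ler_piMr ?specnorm_ge0// (le_trans ej)// exprn_ile1// ltW.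
apply: le_trans (ler_norm_sum _ _ _) _; rewrite mulr_suml.
apply: ler_sum => i _; rewrite mxE; apply: le_trans (ler_norm_sum _ _ _) _.
rewrite mulr_suml.
by apply: ler_sum => j _; rewrite normrM -mulrA ler_wpM2l.
Qed.

Lemma response_trace_le s t : (s <= t)%N ->
  \tr (response F E t s *m (1%:M *t Sigma) *m (response F E t s)^T) <= \tr P.
Proof.
move=> st; rewrite (response_cov lyap)// raddfB /= gerBl.
exact: posdefmx_congr_trace_ge0.
Qed.

(** The left side is the expectation of [<z_(s+3), zeta>]; it exceeds by at most a geometrically
    small term the limit that [exists_descent] makes negative. *)
Lemma response_cross_trace (S0 S1 S2 : 'M[R]_n) : exists2 k, 0 <= k & 
  forall s L, L = response F E s.+3 ->
  \tr ((S0 *m L s.+3 + S1 *m (L s.+2 - L s.+1) + S2 *m (L s.+1 - L s)) *m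
       (1%:M *t Sigma) *m (L s.+3)^T) <=
  \tr (S0 *m P) + \tr (S1 *m (P *m F^T - P *m F^T *m F^T)) +
  \tr (S2 *m (P *m F^T *m F^T - P *m F^T *m F^T *m F^T)) + k * rho ^+ s :> R.
Proof.
(* The four matrices are the coefficients, after cyclic permutation under the trace, of the
   transients at times [s + 3], [s + 2], [s + 1] and [s]. *)
have [k0 k00 D0] := transient_trace_decay S0.
have [k1 k10 D1] := transient_trace_decay (F^T *m S1).
have [k2 k20 D2] := transient_trace_decay (F^T *m F^T *m (S2 - S1)).
have [k3 k30 D3] := transient_trace_decay (F^T *m F^T *m F^T *m S2).
exists (k0 + k1 + k2 + k3); first by rewrite !addr_ge0.
move=> s _ ->; set L := response F E s.+3; pose G := (1%:M : 'M[R]_s.+3) *t Sigma.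
have [D DE] : exists D : nat -> 'M[R]_n, forall i, D i = F ^+ i *m P *m (F ^+ i)^T.
  by exists (fun i => F ^+ i *m P *m (F ^+ i)^T).
have decay X k i : 0 <= k ->
    (forall s, `|\tr (X *m (F ^+ s *m P *m (F ^+ s)^T))| <= k * rho ^+ s) ->
    `|\tr (X *m D (i + s)%N)| <= k * rho ^+ s.
  move=> k_ge0 Xk; rewrite DE (le_trans (Xk _))// ler_wpM2l// exprD.
  by rewrite ler_piMl ?exprn_ge0// exprn_ile1// ltW.
move: (decay _ _ 3 k00 D0) (decay _ _ 2 k10 D1) (decay _ _ 1 k20 D2) (decay _ _ 0 k30 D3).
rewrite add0n add1n add2n add3n !ler_norml => B0 B1 B2 B3.
have C3 : L s.+3 *m G *m (L s.+3)^T = P - D s.+3 by rewrite (response_cov lyap)// DE.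
have C2 : L s.+2 *m G *m (L s.+3)^T = (P - D s.+2) *m F^T.
  have := @response_shift_cov R n nw F E Sigma s.+3 s.+2 1.
  by rewrite addn1 expr1 (response_cov lyap)// -DE => ->.
have s1t : (s < s.+3)%N by rewrite ltnS -addn2 leq_addr.
have C1 : L s.+1 *m G *m (L s.+3)^T = (P - D s.+1) *m F^T *m F^T.
  have := @response_shift_cov R n nw F E Sigma s.+3 s.+1 2.
  by rewrite addn2 expr2 -mulmxE trmx_mul (response_cov lyap)// -DE mulmxA => ->.
have C0 : L s *m G *m (L s.+3)^T = (P - D s) *m F^T *m F^T *m F^T.
  have := @response_shift_cov R n nw F E Sigma s.+3 s 3.
  rewrite addn3 (response_cov lyap) -?DE; last exact: ltnW.
  by rewrite exprS expr2 -!mulmxE !trmx_mul !mulmxA => ->.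
rewrite -/G; move: (L s.+3) (L s.+2) (L s.+1) (L s) G C3 C2 C1 C0 => L3 L2 L1 L0 G C3 C2 C1 C0.
have -> : (S0 *m L3 + S1 *m (L2 - L1) + S2 *m (L1 - L0)) *m G *m L3^T =
    S0 *m (L3 *m G *m L3^T) +
    S1 *m (L2 *m G *m L3^T - L1 *m G *m L3^T) +
    S2 *m (L1 *m G *m L3^T - L0 *m G *m L3^T).
  by rewrite !(mulmxDl, mulmxDr, mulNmx, mulmxN) !mulmxA.
rewrite C3 C2 C1 C0.
have cyc (X : 'M[R]_n) : \tr (X *m F^T) = \tr (F^T *m X) by rewrite mxtrace_mulC.
have cyc2 (X : 'M[R]_n) : \tr (X *m F^T *m F^T) = \tr (F^T *m F^T *m X).
  by rewrite cyc mulmxA cyc !mulmxA.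
have cyc3 (X : 'M[R]_n) : \tr (X *m F^T *m F^T *m F^T) = \tr (F^T *m F^T *m F^T *m X).
  by rewrite cyc2 mulmxA cyc !mulmxA.
rewrite !(mulmxDl, mulmxDr, mulNmx, mulmxN, opprD).
move: B0 B1 B2 B3; rewrite !(mulmxDl, mulmxDr, mulNmx, mulmxN).
rewrite !(mxtraceD, raddfN) /= !mulmxA !cyc3 !cyc2 !cyc !mulmxA.
move=> /andP[B0 _] /andP[B1 _] /andP[B2 _] /andP[_ B3].
lra.
Qed.

End Stationary.

(** * Splitting the closed loop *)

(** The part [z] of the state along one disturbance sequence; [response] is its matrix form. *)
Fixpoint noise_response {R : realType} {nx nw : nat} (F : 'M[R]_nx)
    (E : 'M[R]_(nx, nw)) (w : nat -> 'cV[R]_nw) (s : nat) : 'cV[R]_nx :=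
  if s is s'.+1 then F *m noise_response F E w s' + E *m w s' else 0.

Lemma response_stacked {R : realType} {nx nw : nat} (F : 'M[R]_nx)
    (E : 'M[R]_(nx, nw)) t (wbar : (t * nw).-tuple R) s : (s <= t)%N ->
  response F E t s *m stacked wbar = noise_response F E (unstack wbar) s.
Proof.
elim: s => [|s IHs] st /=; first by rewrite mul0mx.
by rewrite mulmxDl -!mulmxA IHs ?(ltnW st)// block_stacked.
Qed.

Section Splitting.
Context {R : realType} {nx nu nw : nat}.
Variables (A : 'M[R]_nx) (B : 'M[R]_(nx, nu)) (E : 'M[R]_(nx, nw)).
Variables (K : 'M[R]_(nu, nx)) (sigma1 : R) (x0 : 'cV[R]_nx).
Variables (w : nat -> 'cV[R]_nw) (x xhat : nat -> 'cV[R]_nx).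
Variables (u : nat -> 'cV[R]_nu) (tau : nat -> option nat).
Hypothesis loop : event_triggered_loop A B E K sigma1 x0 w x xhat u tau.

Let F := A + B *m K.
Let e s := xhat s - x s.
Let d s := x s - noise_response F E w s.

Lemma split_state s : x s = d s + noise_response F E w s.
Proof. by rewrite subrK. Qed.

Lemma split_init : d 0%N = x0.
Proof. by rewrite /d subr0; case: loop. Qed.

Lemma split_step s : d s.+1 = F *m d s + (B *m K) *m e s.
Proof.
rewrite /d /e; case: loop => _ -> -> _ _ _; rewrite /= !mulmxBr mulmxA.
rewrite [F *m x s]mulmxDl.
by apply/colP => i; rewrite !mxE; ring.
Qed.

(** The maximum with 0 covers a negative [sigma1], for which every step triggers and the error
    vanishes. *)
Lemma split_error_le s : enorm (e s) <= Num.max sigma1 0.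
Proof.
have [h0 hS] := event_triggered_xhat loop.
case: s => [|s]; first by rewrite /e h0 subrr enorm0 le_max lexx orbT.
rewrite /e; have [->|[-> le1]] := hS s; first by rewrite subrr enorm0 le_max lexx orbT.
by rewrite le_max le1.
Qed.

Lemma split_error_held s : e s.+1 = 0 \/
  d s.+1 + noise_response F E w s.+1 + e s.+1 = d s + noise_response F E w s + e s.
Proof.
have [_ hS] := event_triggered_xhat loop.
rewrite -!split_state /e; have [->|[-> _]] := hS s; first by left; rewrite subrr.
by right; rewrite !(addrC (x _)) !subrK.
Qed.

(** The scalar recursion [y -> rho y + (1 - rho) b] has the fixed point [b] and contracts towards it
    by [rho]. *)
Lemma split_state_le (rho kappa b : R) : 0 <= rho ->
  (forall v, enorm (F *m v) <= rho * enorm v) ->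
  (forall v, enorm ((B *m K) *m v) <= kappa * enorm v) ->
  (forall s, kappa * enorm (e s) <= (1 - rho) * b) -> 0 <= b ->
  forall s, enorm (d s) <= b + rho ^+ s * enorm x0.
Proof.
move=> rho0 Frho Bkappa eb b0; elim=> [|s IHs].
  by rewrite split_init expr0 mul1r lerDr.
rewrite split_step (le_trans (ler_enormD _ _))//.
have h1 := le_trans (Frho (d s)) (ler_wpM2l rho0 IHs).
have h2 := le_trans (Bkappa (e s)) (eb s).
rewrite exprS; move: (rho ^+ s * enorm x0) (mulrA rho (rho ^+ s) (enorm x0)) h1.
by move=> y <- h1; lra.
Qed.

End Splitting.

(** * Decay of powers and Gram matrices *)

Section PowersVanish.
Local Open Scope classical_set_scope.
Import numFieldNormedType.Exports.

Lemma expr_lt_eventually {R : realType} (rho delta : R) :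
  0 <= rho < 1 -> 0 < delta -> exists s0, forall s, (s0 <= s)%N -> rho ^+ s < delta.
Proof.
move=> /andP[rho0 rho1] delta0.
have /cvgrPdist_lt/(_ _ delta0) : (GRing.exp rho : nat -> R) @ \oo --> (0 : R).
  by apply: cvg_expr; rewrite ger0_norm.
move=> [s0 _ Hs]; exists s0 => s ss; have := Hs s ss.
by rewrite /= sub0r normrN ger0_norm// exprn_ge0.
Qed.

End PowersVanish.

Lemma dotv_gram {R : realType} m n (M M' : 'M[R]_(m, n)) (v : 'cV[R]_n) :
  dotv (M *m v) (M' *m v) = dotv v (M^T *m M' *m v).
Proof. by rewrite dotv_mulmxl mulmxA. Qed.

Lemma mxtrace_gram {R : realType} m n (M M' : 'M[R]_(m, n)) (G : 'M[R]_n) :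
  \tr (M^T *m M' *m G) = \tr (M' *m G *m M^T).
Proof. by rewrite -mulmxA mxtrace_mulC. Qed.

(** * Balancing the gain of the descent direction against the transient *)

Theorem corollaryV1 (R : realType) (nx nu nw : nat)
  (A : 'M[R]_nx) (B : 'M[R]_(nx, nu)) (E : 'M[R]_(nx, nw)) (K : 'M[R]_(nu, nx))
  (Sigma_w : 'M[R]_nw) (eps : R) (P : 'M[R]_nx) (r sigma1 : R)
  (Sigma_pd : posdefmx Sigma_w)
  (eps01 : 0 < eps < 1)
  (AK_lt1 : specnorm (A + B *m K) < 1)
  (AKE_reach : reachable (A + B *m K) E)
  (BK_neq0 : B *m K != 0)
  (P_pd : posdefmx P)
  (P_lyap : (A + B *m K) *m P *m (A + B *m K)^T - P + E *m Sigma_w *m E^T = 0)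
  (r_gt0 : 0 < r)
  (r_large : eps^-1 * \tr P < r ^+ 2)
  (sigma1_le : sigma1 <= (1 - specnorm (A + B *m K)) / specnorm (B *m K)
                         * (r - Num.sqrt (eps^-1 * \tr P)))
  (x xhat : 'cV[R]_nx -> (nat -> 'cV[R]_nw) -> nat -> 'cV[R]_nx)
  (u : 'cV[R]_nx -> (nat -> 'cV[R]_nw) -> nat -> 'cV[R]_nu)
  (tau : 'cV[R]_nx -> (nat -> 'cV[R]_nw) -> nat -> option nat)
  (loop : forall x0 w, event_triggered_loop A B E K sigma1 x0 w
            (x x0 w) (xhat x0 w) (u x0 w) (tau x0 w)) :
  forall x0 : 'cV[R]_nx, exists T : nat, (0 < T)%N /\
    forall t : nat, (T <= t)%N ->
      (worst_case_cvar (ambiguity_set Sigma_w t) eps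
         (fun wbar => (enorm (x x0 (unstack wbar) t) ^+ 2 - r ^+ 2)%R) <= 0)%E.
Proof.
move=> x0; set F := A + B *m K.
pose rho := specnorm F; pose kappa := specnorm (B *m K).
pose c := Num.sqrt (eps^-1 * \tr P).
have [b bc] : exists b, b + c = r by exists (r - c); rewrite subrK.
have [eps0 eps1] := andP eps01.
have nx0 : (0 < nx)%N.
  by case: (nx) (B *m K) BK_neq0 => // M; rewrite (flatmx0 M) eqxx.
have trP := posdefmx_trace_gt0 nx0 P_pd.
have epsP : 0 < eps^-1 * \tr P by rewrite mulr_gt0// invr_gt0.
have c0 : 0 < c by rewrite sqrtr_gt0.
have c2 : c ^+ 2 = eps^-1 * \tr P by rewrite sqr_sqrtr// ltW.
have b0 : 0 < b.
  rewrite -[b](addrK c) bc subr_gt0 -(@ltr_pXn2r _ 2) ?nnegrE ?(ltW c0) ?(ltW r_gt0)//.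
  by rewrite c2.
have rho0 : 0 <= rho by exact: specnorm_ge0.
have Frho v : enorm (F *m v) <= rho * enorm v by exact: enorm_mulmx_le.
have Bkappa v : enorm (B *m K *m v) <= kappa * enorm v by exact: enorm_mulmx_le.
have null_mx n (M : 'M[R]_n) : (forall v, enorm (M *m v) <= 0 * enorm v) -> M = 0.
  move=> M0; apply/matrixP => i j; have := M0 (delta_mx j 0).
  rewrite mul0r -colE => Mj; have : col j M = 0.
    by apply/eqP; apply: contraTT Mj => /enorm_gt0; rewrite -ltNge.
  by move=> /colP/(_ i); rewrite !mxE.
have kappa0 : 0 < kappa.
  rewrite lt0r specnorm_ge0 andbT; apply: contra_neq BK_neq0 => kappa0.
  by apply: null_mx => v; rewrite -kappa0.
pose e wbar s := xhat x0 wbar s - x x0 wbar s.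
pose d wbar s := x x0 wbar s - noise_response F E wbar s.
have eb wbar s : kappa * enorm (e wbar s) <= (1 - rho) * b.
  have := split_error_le (loop x0 wbar) s => /(ler_wpM2l (ltW kappa0)) /le_trans; apply.
  have rb : 0 <= (1 - rho) * b by rewrite mulr_ge0 ?subr_ge0 ?ltW.
  rewrite maxr_pMr ?(ltW kappa0)// mulr0 ge_max rb andbT.
  have := ler_wpM2l (ltW kappa0) sigma1_le; rewrite -/c -bc addrK -/rho -/kappa => /le_trans; apply.
  by rewrite mulrCA mulrA divfK ?gt_eqF// mulrC.
have db wbar s : enorm (d wbar s) <= b + rho ^+ s * enorm x0.
  by have := split_state_le (loop x0 wbar) rho0 Frho Bkappa (eb wbar) (ltW b0) s.
have xE wbar s : x x0 wbar s = d wbar s + noise_response F E wbar s.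
  by rewrite subrK.
have dS wbar s : d wbar s.+1 = F *m d wbar s + (B *m K) *m e wbar s.
  exact: split_step (loop x0 wbar) s.
(* With [beta = r b - r^2], the loss minus [beta] is [|x|^2 - r b], and the threshold
   [- eps beta = eps r c] is [(r / c) tr P]. *)
have target : - (eps * (r * b - r ^+ 2)) = r / c * \tr P.
  have -> : \tr P = eps * c ^+ 2 by rewrite c2 mulrA divff ?mul1r// gt_eqF.
  by rewrite -bc; field; rewrite gt_eqF.
(* When [rho = 0] the transient is gone after one step, and the weighted triangle inequality
   suffices; the extremal analysis divides by [rho]. *)
have [rhoE|rho_neq0] := eqVneq rho 0.
  exists 1%N; split=> // t t0.
  apply: (@worst_case_cvar_le0 _ _ _ _ _ 0 (r * b - r ^+ 2)
    ((r / c) *: ((response F E t t)^T *m response F E t t))) => //; last first.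
    rewrite target add0r -scalemxAl mxtraceZ mxtrace_gram.
    by rewrite ler_pM2l ?divr_gt0// (response_trace_le P_pd P_lyap).
  move=> wbar; rewrite add0r -scalemxAl dotvZr -dotv_gram -sqr_enorm.
  rewrite ge_max mulr_ge0 ?sqr_ge0 ?divr_ge0 ?(ltW r_gt0) ?(ltW c0)// andbT.
  rewrite response_stacked// xE (addrC (d _ _)).
  have := enorm_sqrD_weighted b0 (noise_response F E (unstack wbar) t) (d (unstack wbar) t) c0.
  have : enorm (d (unstack wbar) t) ^+ 2 <= b ^+ 2.
    rewrite ler_pXn2r ?nnegrE ?(ltW b0)// (le_trans (db _ _))//.
    by rewrite rhoE expr0n gtn_eqF// mul0r addr0.
  have rb : 0 <= r / b by rewrite divr_ge0 ?ltW.
  move=> /(ler_wpM2l rb); have -> : r / b * b ^+ 2 = r * b by field; rewrite gt_eqF.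
  by rewrite bc => ? ?; lra.
have rho01 : 0 < rho < 1 by rewrite lt0r rho_neq0 rho0.
pose V := ((1 - rho) / kappa ^+ 2) *: (B *m K)^T.
have [S0 [S1 [S2 [S0F SN descent]]]] := exists_descent
  ((V + rho^-1 *: F^T) *m (rho^-1 *: F^T - 1%:M)) nx0 rho01 P_pd Frho.
have [k k0 bound] := state_bound rho01 kappa0 b0 Frho Bkappa S0F SN c0 (enorm_ge0 x0).
have [k' k'0 cross] := response_cross_trace rho0 AK_lt1 Frho P_lyap S0 S1 S2.
set g := (X in X < 0) in descent; rewrite -/g in cross.
have rc0 : 0 < r / c by rewrite divr_gt0.
(* The gain is [eta G] and the quadratic loss at most [m eta^2]: four responses of second moment at
   most [tr P], plus a constant. *)
pose G := r / c * (2 * - g).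
have G0 : 0 < G by rewrite mulr_gt0// mulr_gt0// oppr_gt0.
pose m := k * (1 + 4 * \tr P).
have m0 : 0 < m by rewrite mulr_gt0// addr_gt0// mulr_gt0.
(* This maximizes [eta G - m eta^2] and leaves [eta G / 2] to absorb the transient. *)
pose eta := G / (2 * m).
have eta0 : 0 < eta by rewrite divr_gt0// mulr_gt0.
have etam : m * eta ^+ 2 = eta * G / 2 by rewrite /eta; field; rewrite gt_eqF.
move: eta eta0 etam => eta eta0 etam.
(* The total coefficient of [rho^s]: the deviation of the cross covariance from its limit, and the
   trace of the initial state. *)
pose M := r / c * (2 * eta * k') + k * enorm x0.
have M0 : 0 <= M.
  apply: addr_ge0; first by rewrite mulr_ge0 ?(ltW rc0)// mulr_ge0// mulr_ge0// ltW.
  by rewrite mulr_ge0// ltW.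
have M1 : 0 < M + 1 by rewrite ltr_wpDl.
have delta0 : 0 < eta * G / 2 / (M + 1).
  by apply: divr_gt0 => //; apply: divr_gt0 => //; exact: mulr_gt0.
have rho01' : 0 <= rho < 1 by rewrite rho0 AK_lt1.
have [s0 small] := expr_lt_eventually rho01' delta0.
(* Three further steps, since [zeta] reaches back to the response three steps earlier. *)
exists s0.+3; split=> // t; case: t => [//|[//|[//|s]]] s0s.
have {small}rhoM : rho ^+ s * M <= eta * G / 2.
  have := small s s0s; rewrite ltr_pdivlMr// => /ltW; apply: le_trans.
  by rewrite ler_wpM2l ?exprn_ge0// lerDl.
pose L := response F E s.+3.
pose Z := S0 *m L s.+3 + S1 *m (L s.+2 - L s.+1) + S2 *m (L s.+1 - L s).
(* The majorant of [state_bound] as a quadratic form in the stacked disturbance. *)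
pose Q := (r / c) *: ((L s.+3)^T *m L s.+3 + (2 * eta) *: ((L s.+3)^T *m Z)) +
  (k * eta ^+ 2) *: ((L s.+3)^T *m L s.+3 + (L s.+2)^T *m L s.+2 +
                     (L s.+1)^T *m L s.+1 + (L s)^T *m L s).
pose theta := rho ^+ s * enorm x0.
apply: (@worst_case_cvar_le0 _ _ _ _ _ (k * theta + k * eta ^+ 2) (r * b - r ^+ 2) Q) => //.
  move=> wbar; set w := unstack wbar.
  have Lz i : (i <= s.+3)%N -> L i *m stacked wbar = noise_response F E w i.
    exact: response_stacked.
  have th : 0 <= theta <= enorm x0.
    by rewrite mulr_ge0 ?exprn_ge0//= ler_piMl// exprn_ile1// ltW.
  have := bound (d w) (e w) (noise_response F E w) s theta eta th (ltW eta0)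
    (db w s) (dS w) (eb w) (split_error_held (loop x0 w)) _ erefl.
  rewrite -xE bc opprB addrA subrK => /le_trans; apply.
  have s0t : (s <= s.+3)%N by rewrite -addn3 leq_addr.
  have s1t : (s.+1 <= s.+3)%N by rewrite -addn2 leq_addr.
  have ZE : Z *m stacked wbar = S0 *m noise_response F E w s.+3 +
      S1 *m (noise_response F E w s.+2 - noise_response F E w s.+1) +
      S2 *m (noise_response F E w s.+1 - noise_response F E w s).
    by rewrite !mulmxDl -!mulmxA !mulmxBl !Lz.
  have -> : dotv (stacked wbar) (Q *m stacked wbar) =
      r / c * (enorm (noise_response F E w s.+3) ^+ 2 +
        2 * eta * dotv (noise_response F E w s.+3) (Z *m stacked wbar)) +
      k * eta ^+ 2 * (enorm (noise_response F E w s.+3) ^+ 2 +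
        enorm (noise_response F E w s.+2) ^+ 2 +
        enorm (noise_response F E w s.+1) ^+ 2 + enorm (noise_response F E w s) ^+ 2).
    rewrite -!Lz// !sqr_enorm !dotv_gram.
    by rewrite /Q !mulmxDl -!scalemxAl !mulmxDl -!scalemxAl !(dotvDr, dotvZr).
  by rewrite -ZE; lra.
rewrite target.
have := cross s _ erefl; rewrite -/L -/Z => crossZ.
have C i : (i <= s.+3)%N -> \tr (L i *m (1%:M *t Sigma_w) *m (L i)^T) <= \tr P.
  by move=> it; have := response_trace_le P_pd P_lyap it.
have s0t : (s <= s.+3)%N by rewrite -addn3 leq_addr.
have s1t : (s.+1 <= s.+3)%N by rewrite -addn2 leq_addr.
have C0 := C _ s0t; have C1 := C _ s1t; have C2 := C _ (leqnSn s.+2).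
have C3 := C _ (leqnn s.+3).
have -> : \tr (Q *m (1%:M *t Sigma_w)) =
  r / c * (\tr (L s.+3 *m (1%:M *t Sigma_w) *m (L s.+3)^T) +
    2 * eta * \tr (Z *m (1%:M *t Sigma_w) *m (L s.+3)^T)) +
  k * eta ^+ 2 * (\tr (L s.+3 *m (1%:M *t Sigma_w) *m (L s.+3)^T) +
    \tr (L s.+2 *m (1%:M *t Sigma_w) *m (L s.+2)^T) +
    \tr (L s.+1 *m (1%:M *t Sigma_w) *m (L s.+1)^T) +
    \tr (L s *m (1%:M *t Sigma_w) *m (L s)^T)).
  rewrite -!mxtrace_gram /Q !mulmxDl -!scalemxAl !mulmxDl -!scalemxAl.
  by rewrite !(mxtraceD, mxtraceZ).
have B1 : r / c * (\tr (L s.+3 *m (1%:M *t Sigma_w) *m (L s.+3)^T) +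
    2 * eta * \tr (Z *m (1%:M *t Sigma_w) *m (L s.+3)^T)) <=
    r / c * (\tr P + 2 * eta * (g + k' * rho ^+ s)).
  by rewrite ler_pM2l// lerD// ler_wpM2l// mulr_ge0// ltW.
have B2 : k * eta ^+ 2 * (\tr (L s.+3 *m (1%:M *t Sigma_w) *m (L s.+3)^T) +
    \tr (L s.+2 *m (1%:M *t Sigma_w) *m (L s.+2)^T) +
    \tr (L s.+1 *m (1%:M *t Sigma_w) *m (L s.+1)^T) +
    \tr (L s *m (1%:M *t Sigma_w) *m (L s)^T)) <= k * eta ^+ 2 * (4 * \tr P).
  apply: ler_wpM2l; first by rewrite mulr_ge0 ?sqr_ge0// ltW.
  by lra.
move: (r / c * _) (k * eta ^+ 2 * _) B1 B2 => X Y B1 B2.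
apply: (@le_trans _ _ (k * theta + k * eta ^+ 2 +
  (r / c * (\tr P + 2 * eta * (g + k' * rho ^+ s)) + k * eta ^+ 2 * (4 * \tr P)))).
  by rewrite lerD2l lerD.
(* The terms regroup as threshold, quadratic loss, transient and gain; the loss and the transient
   are each at most half of the gain. *)
have -> : k * theta + k * eta ^+ 2 +
  (r / c * (\tr P + 2 * eta * (g + k' * rho ^+ s)) + k * eta ^+ 2 * (4 * \tr P)) =
  r / c * \tr P + m * eta ^+ 2 + rho ^+ s * M - eta * G.
  by rewrite /theta /m /M /G; move: (r / c) (rho ^+ s) => y z; ring.
rewrite etam; lra.
Qed.
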